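(* Let $V$ be a dg vector space with a weakly non-degenerate inner product $\langle,\rangle$. For each $n$ let $\mathrm E_c(V)(n)\subset\mathrm E(V)(n)=\mathrm{Hom}(V^{\otimes n},V)$ be the subspace of those multilinear maps $f$ such that for every $\sigma\in S_{n+1}$ the element $\sigma(\alpha(f))$ lies in the image of $\alpha$. Then $\mathrm E_c(V)$, with operad structure maps determined by requiring it to be a suboperad of $\mathrm E(V)$ and with the action of $S_{n+1}$ on $\mathrm E_c(V)(n)$ determined by the inclusion $\alpha\colon\mathrm E_c(V)(n)\hookrightarrow(V^* )^{\otimes n+1}$, is a cyclic operad.
   Context: The ground field has characteristic zero; vector spaces are $\mathbb Z/2$-graded, signs follow the Koszul rule. An inner product is a symmetric bilinear form compatible with the differential; weakly non-degenerate means that the induced map $V\to V^*$ is injective. $\mathrm E(V)$ is the endomorphism operad of $V$. Here $(V^* )^{\otimes n+1}$ denotes the completed tensor product, i.e. $(V^{\otimes n+1})^*$, and $\alpha\colon\mathrm{Hom}(V^{\otimes n},V)\cong(V^* )^{\otimes n}\otimes V\to(V^* )^{\otimes n+1}$ is the map induced by $V\to V^*$, i.e. $\alpha(f)(v_1,\dots,v_{n+1})=\langle f(v_1,\dots,v_n),v_{n+1}\rangle$; it is injective by weak non-degeneracy. Cyclic operads are in the sense of Getzler–Kapranov: writing $f\mapsto f^*$ for the action of the cycle $(1\,2\,\cdots\,n+1)$ on the arity $n$ component, the compatibility is $(f\circ_ng)^*=g^*\circ_1f^*$ (up to Koszul sign) for $f$ of arity $n$. *)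

(* Defs.v *)
From HB Require Import structures.
From mathcomp Require Import all_boot all_order all_algebra all_fingroup.
From mathcomp Require Import boolp classical_sets functions.

Set Implicit Arguments.
Unset Strict Implicit.
Unset Printing Implicit Defensive.

Import GRing.Theory.
Local Open Scope ring_scope.

(** Z/2-graded dg vector spaces.  The parity of a homogeneous vector is a
    boolean ([true] is odd, [addb] adds parities); [gproj b] is the projection
    onto the component of parity [b]. *)

Record dgStructure (k : fieldType) (M : lmodType k) := DgStructure {
  gproj : bool -> {linear M -> M};
  dgd : {linear M -> M};
  gproj_proj : forall a b v, gproj a (gproj b v) = if a == b then gproj b v else 0;
  gproj_sum : forall v, gproj false v + gproj true v = v;
  dgd_odd : forall b v, dgd (gproj b v) = gproj (~~ b) (dgd v);
  dgd_dgd : forall v, dgd (dgd v) = 0 }.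

Structure dgModType (k : fieldType) := DgModType {
  dg_sort :> lmodType k;
  dg_str : dgStructure dg_sort }.

Definition gpr (k : fieldType) (V : dgModType k) (b : bool) : {linear V -> V} :=
  gproj (dg_str V) b.

Definition diff (k : fieldType) (V : dgModType k) : {linear V -> V} :=
  dgd (dg_str V).

Definition homog (k : fieldType) (V : dgModType k) (b : bool) (v : V) : Prop :=
  gpr V b v = v.

(** [tw b v] is (-1)^(b |v|) v: the sign for exchanging [v] with a symbol of
    parity [b]. *)
Definition tw (k : fieldType) (V : dgModType k) (b : bool) (v : V) : V :=
  gpr V false v + (-1) ^+ b *: gpr V true v.

(** The signs below do not involve [ip_parity]: they are the same for even and
    for odd inner products. *)
Record innerProduct (k : fieldType) (V : dgModType k) := InnerProduct {
  ip :> V -> V -> k;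
  ip_parity : bool;
  ip_linearl : forall w, scalar (ip^~ w);
  ip_linearr : forall v, scalar (ip v);
  ip_homog : forall a b v w, homog a v -> homog b w ->
    a (+) b != ip_parity -> ip v w = 0;
  ip_sym : forall a b v w, homog a v -> homog b w ->
    ip v w = (-1) ^+ (a && b) * ip w v;
  ip_diff : forall a v w, homog a v ->
    ip (diff V v) w + (-1) ^+ a * ip v (diff V w) = 0 }.

Definition weakly_nondegenerate (k : fieldType) (V : dgModType k)
    (form : innerProduct V) : Prop :=
  injective (fun v : V => form v).

(** A permutation in ['S_n] acts on maps of n variables by
    (s phi)(v_1, ..., v_n) = +- phi(v_(s 1), ..., v_(s n)).  For the usual
    product of permutations this is a left action; the product of ['S_n] is the
    opposite one ([(s * t) i = t (s i)]), whence the order in [op_actM]. *)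

Record dgOperad (k : fieldType) (O : nat -> dgModType k) := DgOperad {
  op_id : O 1;
  op_act : forall n, 'S_n -> O n -> O n;
  (* [op_comp _ i f g] plugs [g] into the input [i] of [f]; inputs are numbered
     from 0, and p is the arity m + n - 1 of the result. *)
  op_comp : forall m n p, (m + n = p.+1)%N -> 'I_m -> O m -> O n -> O p;

  op_act_linear : forall n (s : 'S_n), linear (op_act s);
  op_act_gpr : forall n (s : 'S_n) b f, op_act s (gpr (O n) b f) = gpr (O n) b (op_act s f);
  op_act_diff : forall n (s : 'S_n) f, op_act s (diff (O n) f) = diff (O n) (op_act s f);
  op_act1 : forall n f, op_act (1%g : 'S_n) f = f;
  op_actM : forall n (s t : 'S_n) f, op_act (s * t)%g f = op_act t (op_act s f);

  op_comp_linearl : forall m n p (e : (m + n = p.+1)%N) i (g : O n),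
    linear (fun f : O m => op_comp e i f g);
  op_comp_linearr : forall m n p (e : (m + n = p.+1)%N) i (f : O m),
    linear (fun g : O n => op_comp e i f g);
  op_comp_homog : forall m n p (e : (m + n = p.+1)%N) i a b (f : O m) (g : O n),
    homog a f -> homog b g -> homog (a (+) b) (op_comp e i f g);
  op_comp_diff : forall m n p (e : (m + n = p.+1)%N) i a (f : O m) (g : O n),
    homog a f ->
    diff (O p) (op_comp e i f g) =
      op_comp e i (diff (O m) f) g + (-1) ^+ a *: op_comp e i f (diff (O n) g);

  op_id_homog : homog false op_id;
  op_id_diff : diff (O 1) op_id = 0;
  op_compf1 : forall m (e : (m + 1 = m.+1)%N) i (f : O m), op_comp e i f op_id = f;
  op_comp1f : forall m (e : (1 + m = m.+1)%N) i (f : O m), op_comp e i op_id f = f;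

  op_comp_seq : forall m n l p q r
      (e1 : (m + n = p.+1)%N) (e2 : (p + l = r.+1)%N)
      (e3 : (n + l = q.+1)%N) (e4 : (m + q = r.+1)%N)
      (i : 'I_m) (j : 'I_n) (x : 'I_p) (f : O m) (g : O n) (h : O l),
    x = (i + j)%N :> nat ->
    op_comp e2 x (op_comp e1 i f g) h = op_comp e4 i f (op_comp e3 j g h);
  op_comp_par : forall m n l p q r
      (e1 : (m + n = p.+1)%N) (e2 : (p + l = r.+1)%N)
      (e3 : (m + l = q.+1)%N) (e4 : (q + n = r.+1)%N)
      (i j : 'I_m) (x : 'I_p) (y : 'I_q) b c (f : O m) (g : O n) (h : O l),
    (i < j)%N -> x.+1 = (j + n)%N :> nat -> y = i :> nat ->
    homog b g -> homog c h ->
    op_comp e2 x (op_comp e1 i f g) h =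
      (-1) ^+ (b && c) *: op_comp e4 y (op_comp e3 j f h) g;

  (* [r] is the permutation acting by [t] inside the block of the inputs of [g]
     and by [s] on the other inputs and the block; the two conditions determine
     it. *)
  op_comp_act : forall m n p (e : (m + n = p.+1)%N) (i : 'I_m)
      (s : 'S_m) (t : 'S_n) (r : 'S_p) (f : O m) (g : O n),
    (forall (j : 'I_n) (x : 'I_p), x = (i + j)%N :> nat ->
       r x = (s i + t j)%N :> nat) ->
    (forall (j : 'I_m) (x : 'I_p), j != i ->
       x = (if j < i then j : nat else (j + n).-1)%N :> nat ->
       r x = (if s j < s i then s j : nat else (s j + n).-1)%N :> nat) ->
    op_comp e (s i) (op_act s f) (op_act t g) = op_act r (op_comp e i f g) }.

(** The cycle (1 2 ... n+1). *)
Definition cycle_perm (n : nat) : 'S_n.+1 := perm (@ordS_inj n.+1).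

Record cyclicOperad (k : fieldType) (O : nat -> dgModType k) := CyclicOperad {
  cyc_operad :> dgOperad O;
  cyc_act : forall n, 'S_n.+1 -> O n -> O n;

  cyc_act_linear : forall n (s : 'S_n.+1), linear (cyc_act s);
  cyc_act_gpr : forall n (s : 'S_n.+1) b f,
    cyc_act s (gpr (O n) b f) = gpr (O n) b (cyc_act s f);
  cyc_act_diff : forall n (s : 'S_n.+1) f,
    cyc_act s (diff (O n) f) = diff (O n) (cyc_act s f);
  cyc_act1 : forall n f, cyc_act (1%g : 'S_n.+1) f = f;
  cyc_actM : forall n (s t : 'S_n.+1) f,
    cyc_act (s * t)%g f = cyc_act t (cyc_act s f);

  (* S_n is the stabilizer of n+1 in S_{n+1}. *)
  cyc_act_lift : forall n (s : 'S_n) f,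
    cyc_act (lift_perm ord_max ord_max s) f = op_act cyc_operad s f;
  cyc_id : cyc_act (cycle_perm 1) (op_id cyc_operad) = op_id cyc_operad;
  (* (f o_m g)^* = +- g^* o_1 f^* for f of arity m and g of positive arity. *)
  cyc_comp_last : forall m n p (e : (m + n = p.+1)%N) (e' : (n + m = p.+1)%N)
      (i : 'I_m) (j : 'I_n) a b (f : O m) (g : O n),
    i.+1 = m -> j = 0%N :> nat -> homog a f -> homog b g ->
    cyc_act (cycle_perm p) (op_comp cyc_operad e i f g) =
      (-1) ^+ (a && b) *:
        op_comp cyc_operad e' j (cyc_act (cycle_perm n) g) (cyc_act (cycle_perm m) f);
  (* (f o_i g)^* = f^* o_{i+1} g for i < m.  For g of positive arity this
     follows from the previous axiom and equivariance, but when g has arity 0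
     the previous axiom is void. *)
  cyc_comp : forall m n p (e : (m + n = p.+1)%N) (i i' : 'I_m) (f : O m) (g : O n),
    i' = i.+1 :> nat ->
    cyc_act (cycle_perm p) (op_comp cyc_operad e i f g) =
      op_comp cyc_operad e i' (cyc_act (cycle_perm m) f) g }.

Definition multilinear (k : fieldType) (V W : lmodType k) (n : nat)
    (f : ('I_n -> V) -> W) : Prop :=
  forall (v : 'I_n -> V) (i : 'I_n), linear (fun x => f [eta v with i |-> x]).

(** [e i] is the parity of the i-th variable; reordering the variables as
    v_(s 1), ..., v_(s n) produces one sign per exchanged pair of odd ones. *)
Definition koszul_sign (k : fieldType) (n : nat) (s : 'S_n) (e : 'I_n -> bool) : k :=
  \prod_(i < n) \prod_(j < n | (i < j)%N && (s j < s i)%N) (-1) ^+ (e (s i) && e (s j)).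

(** The action of a permutation on graded maps of n variables, as a sum over
    all the parity patterns of the variables. *)
Definition perm_act (k : fieldType) (V : dgModType k) (W : lmodType k) (n : nat)
    (s : 'S_n) (phi : ('I_n -> V) -> W) : ('I_n -> V) -> W :=
  fun v => \sum_(e : {ffun 'I_n -> bool})
    koszul_sign k s e *: phi (fun i => gpr V (e (s i)) (v (s i))).

(** The operations of the endomorphism operad E(V); an element of
    E(V)(n) = Hom(V^(x)n, V) is a [multilinear] map [('I_n -> V) -> V]. *)

Definition endo_gpr (k : fieldType) (V : dgModType k) (n : nat) (b : bool)
    (f : ('I_n -> V) -> V) : ('I_n -> V) -> V :=
  fun v => \sum_(e : {ffun 'I_n -> bool})
    gpr V (b (+) \big[addb/false]_(i < n) e i) (f (fun i => gpr V (e i) (v i))).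

(** d(f(v_1, ..., v_n))
      - sum_i (-1)^(|f| + |v_1| + ... + |v_(i-1)|) f(v_1, ..., d v_i, ..., v_n) *)
Definition endo_diff (k : fieldType) (V : dgModType k) (n : nat)
    (f : ('I_n -> V) -> V) : ('I_n -> V) -> V :=
  fun v => diff V (f v) -
    \sum_(b : bool) \sum_(i < n) (-1) ^+ b *: endo_gpr b f
      (fun j => if (j < i)%N then tw true (v j)
                else if j == i then diff V (v j) else v j).

Definition endo_id (k : fieldType) (V : dgModType k) : ('I_1 -> V) -> V :=
  fun v => v ord0.

(** The vector at position [x]; the default value 0 is never reached in
    [endo_comp] when m + n = p + 1. *)
Definition slot (k : fieldType) (V : dgModType k) (p : nat) (v : 'I_p -> V)
    (x : nat) : V :=
  oapp v 0 (insub x).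

(** (-1)^(|g| (|v_0| + ... + |v_(i-1)|))
      f(v_0, ..., v_(i-1), g(v_i, ..., v_(i+n-1)), v_(i+n), ..., v_(m+n-2)) *)
Definition endo_comp (k : fieldType) (V : dgModType k) (m n p : nat) (i : 'I_m)
    (f : ('I_m -> V) -> V) (g : ('I_n -> V) -> V) : ('I_p -> V) -> V :=
  fun v => \sum_(b : bool) f
    (fun j => if (j < i)%N then tw b (slot v j)
              else if j == i then endo_gpr b g (fun l => slot v (i + l))
              else slot v (j + n).-1).

(** The map from Hom(V^(x)n, V) to (V^(x)n+1)^* *)
Definition alpha (k : fieldType) (V : dgModType k) (form : innerProduct V)
    (n : nat) (f : ('I_n -> V) -> V) : ('I_n.+1 -> V) -> k^o :=
  fun v => form (f (fun j => v (lift ord_max j))) (v ord_max).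

Definition in_Ec (k : fieldType) (V : dgModType k) (form : innerProduct V)
    (n : nat) (f : ('I_n -> V) -> V) : Prop :=
  multilinear f /\
  forall s : 'S_n.+1, exists2 h : ('I_n -> V) -> V,
    multilinear h & perm_act s (alpha form f) = alpha form h.

Section EcSpace.
Variables (k : fieldType) (V : dgModType k) (form : innerProduct V) (n : nat).

Definition Ec_pred : {pred ('I_n -> V) -> V} := fun f => `[< in_Ec form f >].

Lemma multilinearP (a : k) (f g : ('I_n -> V) -> V) :
  multilinear f -> multilinear g -> multilinear (a *: f + g).
Proof.
move=> hf hg v i c x y.
rewrite -!/((a *: f + g) _).
have E w : (a *: f + g) w = a *: f w + g w by [].
by rewrite !E hf hg !scalerDr !scalerA mulrC addrACA.
Qed.

Lemma multilinear0 : multilinear (0 : ('I_n -> V) -> V).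
Proof. by move=> v i c x y; rewrite -[RHS]/(c *: 0 + 0) scaler0 addr0. Qed.

Lemma alphaP (a : k) (f g : ('I_n -> V) -> V) :
  alpha form (a *: f + g) = a *: alpha form f + alpha form g.
Proof. by apply/funext => v; exact: (ip_linearl form). Qed.

Lemma alpha0 : alpha form (0 : ('I_n -> V) -> V) = 0.
Proof. by have := alphaP (-1) 0 0; rewrite scaler0 addr0 scaleN1r addNr.
Qed.

Lemma perm_actP (W : lmodType k) m (s : 'S_m) (a : k) (f g : ('I_m -> V) -> W) :
  perm_act s (a *: f + g) = a *: perm_act s f + perm_act s g.
Proof.
apply/funext => v; rewrite -[RHS]/(a *: perm_act s f v + perm_act s g v).
rewrite /perm_act scaler_sumr -big_split; apply: eq_bigr => e _ /=.
by rewrite -[(a *: f + g) _]/(a *: f _ + g _) scalerDr !scalerA mulrC.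
Qed.

Lemma Ec_submod_closed : submod_closed Ec_pred.
Proof.
have PE f : f \in Ec_pred -> in_Ec form f by move/asboolP.
split=> [|a f g /PE [hf Hf] /PE [hg Hg]]; apply/asboolP; split.
- exact: multilinear0.
- move=> s; exists 0; first exact: multilinear0.
  rewrite alpha0; apply/funext => v; rewrite /perm_act big1 // => e _.
  by rewrite -[(0 : _ -> _) _]/(0 : k^o) scaler0.
- exact: multilinearP.
- move=> s; have [h1 m1 e1] := Hf s; have [h2 m2 e2] := Hg s.
  exists (a *: h1 + h2); first exact: multilinearP.
  by rewrite !alphaP perm_actP e1 e2.
Qed.

HB.instance Definition _ :=
  GRing.isSubmodClosed.Build k (('I_n -> V) -> V) Ec_pred Ec_submod_closed.

(** The space E_c(V)(n). *)
Record Ec := MkEc { Ec_val :> ('I_n -> V) -> V; _ : Ec_val \in Ec_pred }.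

HB.instance Definition _ := [isSub for Ec_val].
HB.instance Definition _ := [Choice of Ec by <:].
HB.instance Definition _ := [SubChoice_isSubLmodule of Ec by <:].

End EcSpace.

Definition is_suboperad (k : fieldType) (V : dgModType k) (form : innerProduct V)
    (D : forall n, dgStructure (Ec form n))
    (O : dgOperad (fun n => DgModType (D n))) : Prop :=
  [/\ (forall n b (f : Ec form n), Ec_val (gproj (D n) b f) = endo_gpr b f) /\
      (forall n (f : Ec form n), Ec_val (dgd (D n) f) = endo_diff f),
      Ec_val (op_id O) = endo_id (V := V),
      forall n (s : 'S_n) (f : Ec form n), Ec_val (op_act O s f) = perm_act s f
    & forall m n p (e : (m + n = p.+1)%N) (i : 'I_m) (f : Ec form m) (g : Ec form n),
        Ec_val (op_comp O e i f g) = endo_comp i f g].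

(* Main.v *)
Require Import Defs.
From HB Require Import structures.
From mathcomp Require Import all_boot all_order all_algebra all_fingroup.
From mathcomp Require Import boolp classical_sets functions.
From mathcomp Require Import zify.

Set Implicit Arguments.
Unset Strict Implicit.
Unset Printing Implicit Defensive.

Import GRing.Theory.
Local Open Scope ring_scope.

(** Write f* for the multilinear map representing the image of alpha(f) under
    the cycle, when there is one.  The only point of substance is that the maps
    f all of whose rotations are representable are stable under partial
    composition; then all the structure is determined by alpha, which is
    injective by weak non-degeneracy, and every axiom on the action of S_(n+1)
    is an identity between multilinear forms.

    For stability, the cycle sends a composite of two maps of E_c to a composite
    of two maps of E_c: up to sign, (f o_i g)* is f* o_(i+1) g when i is not the
    last input of f, and g* o_1 f* when it is ([endo_comp_rotate],
    [endo_comp_rotate_last]).  When the last input of f is filled by an element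
    g of V there is no g* to use, but symmetry of the form gives
    (f o_m g)* = f** o_1 g ([endo_comp_rotate_last0]): the cycle moves that slot
    to the output of f and then on to its first input.  So every power of the
    cycle sends alpha of a composite to alpha of a composite.  This suffices,
    because S_(n+1) consists of products of a power of the cycle and a
    permutation fixing the last point ([cycle_lift_decomp]), and the latter
    preserve the image of alpha ([alpha_perm_lift]).  The differential
    preserves E_c because, on forms, it is the total derivation
    ([ev_alpha_diff]), which treats all n+1 variables alike.

    All the identities are checked on homogeneous vectors, which determine a
    multilinear map ([ev_ext]).  There each operation is a sign times a plain
    formula ([ev_perm_act], [ev_endo_diff], [ev_endo_comp]), and an axiom
    splits into an equality of arguments and an equality of signs.  The
    arguments are indexed by all natural numbers rather than by ordinals, so
    the first is arithmetic on positions.  Signs are handled through their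
    exponents, which are booleans; the facts needed about the Koszul sign are
    its cocycle rule ([koszul_parityM]), its behaviour when one parity changes
    ([koszul_parity_flip]) and its behaviour on block permutations
    ([koszul_parity_block]). *)

(** * Sums of parities *)

(** The arguments of f in (f o_i g)(u), where g has arity n and w is its value: w
    replaces the n entries of u that start at position i. *)
Definition insert_block T (i n : nat) (u : nat -> T) (w : T) : nat -> T :=
  fun j => if (j < i)%N then u j else if j == i then w else u (j + n).-1.

Definition shift T (i : nat) (u : nat -> T) : nat -> T := fun l => u (i + l)%N.

(** Sums over the p inputs of f o_i g are grouped by the input of f from which
    they come: the n inputs of g form one group, at position i. *)
Lemma big_insert_block (T : Type) (idx : T) (op : Monoid.com_law idx) m n p i
    (F : nat -> T) : (m + n = p.+1)%N -> (i < m)%N ->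
  \big[op/idx]_(0 <= x < p) F x =
  \big[op/idx]_(0 <= j < m)
     insert_block i n F (\big[op/idx]_(0 <= l < n) F (i + l)%N) j.
Proof.
move=> e lim.
rewrite (@big_cat_nat _ _ _ i) /=; [|lia|lia].
rewrite [X in _ = X](@big_cat_nat _ _ _ i) /=; [|lia|lia].
congr (op _ _).
  by apply: eq_big_nat => j /andP[_ ji]; rewrite /insert_block ji.
rewrite (@big_cat_nat _ _ _ (i + n)%N) /=; [|lia|lia].
rewrite [X in _ = X](@big_cat_nat _ _ _ i.+1) /=; [|lia|lia].
congr (op _ _).
  rewrite big_nat1 /insert_block ltnn eqxx -{1}[i]add0n big_addn addKn.
  by apply: eq_bigr => l _; rewrite addnC.
rewrite -{1}[(i + n)%N]add0n -[i.+1]add0n !big_addn.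
have -> : (p - (i + n))%N = (m - i.+1)%N by lia.
apply: eq_big_nat => j _; rewrite /insert_block.
rewrite ifF; last by lia.
by rewrite ifF; [congr F; lia | lia].
Qed.

Definition psum (e : nat -> bool) (n : nat) : bool :=
  \big[addb/false]_(0 <= j < n) e j.

Lemma psum0 e : psum e 0 = false.
Proof. by rewrite /psum big_geq. Qed.

Lemma psumS e n : psum e n.+1 = psum e n (+) e n.
Proof. by rewrite /psum big_nat_recr. Qed.

Lemma psumSl e n : psum e n.+1 = e 0%N (+) psum (shift 1 e) n.
Proof. by rewrite /psum big_nat_recl. Qed.

Lemma eq_psum e e' n : (forall j, (j < n)%N -> e j = e' j) -> psum e n = psum e' n.
Proof. by move=> E; apply: eq_big_nat => j /andP[_ /E]. Qed.

Lemma psum_ord (e : nat -> bool) n : \big[addb/false]_(j < n) e j = psum e n.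
Proof. by rewrite /psum big_mkord. Qed.

Lemma psum_widen (e : nat -> bool) i n : (i <= n)%N ->
  psum e i = \big[addb/false]_(j < n) ((j < i)%N && e j).
Proof.
by move=> le; rewrite -psum_ord (big_ord_widen n e le) big_mkcond.
Qed.

Lemma psumD e i n : psum e (i + n) = psum e i (+) psum (shift i e) n.
Proof.
elim: n => [|n IH]; first by rewrite addn0 psum0 addbF.
by rewrite addnS !psumS IH addbA.
Qed.

(** Sign exponents are compared by truth tables, with the values of [psum] as
    atoms. *)
Ltac bool_cases :=
  repeat match goal with |- context [psum ?e ?n] => case: (psum e n) end;
  repeat match goal with b : bool |- _ =>
    match goal with |- context [b] => case: (b) end end; by [].

Lemma sum_delta m i c : (i < m)%N ->
  \big[addb/false]_(0 <= j < m) ((j == i) && c) = c.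
Proof.
move=> lim; rewrite (bigD1_seq i) ?iota_uniq ?mem_index_iota //= eqxx.
by rewrite big1 ?addbF // => j /negbTE ->.
Qed.

(** A map of parity c applied to a block has a value of parity c plus that of the
    block; inserting it therefore changes the total parity by c. *)
Lemma psum_insert_block m n p i e c : (m + n = p.+1)%N -> (i < m)%N ->
  psum (insert_block i n e (c (+) psum (shift i e) n)) m = c (+) psum e p.
Proof.
move=> E lim; rewrite /psum (big_insert_block _ _ E lim) /=.
rewrite -[in RHS](sum_delta c lim) -big_split; apply: eq_bigr => j _ /=.
by rewrite /insert_block; case: ltngtP; rewrite ?addbF.
Qed.

(** * Koszul signs *)

Section NatPerm.
Variables (n : nat) (s : 'S_n).

(** Extended by the identity, so that families indexed by the natural numbers can
    be permuted. *)
Definition nat_perm (x : nat) : nat := oapp (fun i => nat_of_ord (s i)) x (insub x).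

Lemma nat_permE (i : 'I_n) : nat_perm i = s i.
Proof. by rewrite /nat_perm valK. Qed.

Lemma nat_perm_lt x : (x < n)%N -> (nat_perm x < n)%N.
Proof. by move=> lt; rewrite -[x]/(nat_of_ord (Ordinal lt)) nat_permE. Qed.

Lemma psum_perm (e : nat -> bool) : psum (e \o nat_perm) n = psum e n.
Proof.
rewrite -!psum_ord [RHS](reindex_inj (@perm_inj _ s)) /=.
by apply: eq_bigr => i _; rewrite nat_permE.
Qed.

(** The exponent of the Koszul sign: inverted pairs of odd entries, modulo 2. *)
Definition koszul_parity (e : nat -> bool) : bool :=
  \big[addb/false]_(i < n) \big[addb/false]_(j < n)
    [&& i < j, s j < s i, e (s i) & e (s j)]%N.

Lemma koszul_signE (k : fieldType) (e : 'I_n -> bool) (e' : nat -> bool) :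
  (forall i : 'I_n, e i = e' i) -> koszul_sign k s e = (-1) ^+ koszul_parity e'.
Proof.
move=> E; pose sg (b : bool) : k := (-1) ^+ b.
have sgD : {morph sg : x y / x (+) y >-> x * y} by move=> x y; exact: signr_addb.
have sg0 : sg false = 1 by [].
rewrite /koszul_sign -[RHS]/(sg _) /koszul_parity (big_morph sg sgD sg0).
apply: eq_bigr => i _; rewrite (big_morph sg sgD sg0) big_mkcond.
by apply: eq_bigr => j _; rewrite !E andbA; case: andb.
Qed.

(** A sum over unordered pairs is invariant under permutation.  Since the sum is
    modulo 2, it cannot be obtained by halving the sum over ordered pairs; the
    pairs that s inverts are exchanged instead. *)
Lemma sum_pairs_perm (G : 'I_n -> 'I_n -> bool) : (forall i j, G i j = G j i) ->
  \big[addb/false]_(i < n) \big[addb/false]_(j < n) ((i < j)%N && G (s i) (s j)) =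
  \big[addb/false]_(i < n) \big[addb/false]_(j < n) ((i < j)%N && G i j).
Proof.
move=> sym; pose s' i := (s^-1)%g i.
transitivity (\big[addb/false]_(i < n) \big[addb/false]_(j < n) ((s' i < s' j)%N && G i j)).
  rewrite [RHS](reindex_inj (@perm_inj _ s)) /=; apply: eq_bigr => i _.
  rewrite [RHS](reindex_inj (@perm_inj _ s)) /=; apply: eq_bigr => j _.
  by rewrite /s' !permK.
transitivity (\big[addb/false]_(i < n) \big[addb/false]_(j < n)
    ([&& i < j, s' i < s' j & G i j]%N (+) [&& j < i, s' i < s' j & G i j]%N)).
  apply: eq_bigr => i _; apply: eq_bigr => j _.
  by case: (ltngtP i j) => [||/val_inj ->]; rewrite ?ltnn ?addbF.
under eq_bigr do rewrite big_split /=.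
rewrite big_split /= [X in _ (+) X]exchange_big -big_split; apply: eq_bigr => i _ /=.
rewrite -big_split; apply: eq_bigr => j _ /=; rewrite [G j i]sym.
by have [_|_|/val_inj/perm_inj ->] := ltngtP (s' i); rewrite ?ltnn ?andbF ?addbF.
Qed.

(** Changing the parity of the entry s i affects the pairs inverted with i.  An
    index j is inverted with i exactly when one, but not both, of j < i and
    s j < s i holds, so modulo 2 these pairs contribute the sum of the parities
    before i in the permuted family and before s i in the original one. *)
Lemma koszul_parity_flip (e : nat -> bool) (i : 'I_n) b :
  koszul_parity (fun x => e x (+) (b && (x == s i))) =
  koszul_parity e (+) (b && (psum (e \o nat_perm) i (+) psum e (s i))).
Proof.
case: b; last first.
  by rewrite addbF; apply: eq_bigr => x _; apply: eq_bigr => y _; rewrite !addbF.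
have sE x : (s x == s i :> nat) = (x == i) by rewrite (inj_eq val_inj) (inj_eq perm_inj).
rewrite (psum_widen _ (ltnW (ltn_ord i))) (psum_widen e (ltnW (ltn_ord (s i)))).
rewrite [X in _ && (_ (+) X)](reindex_inj (@perm_inj _ s)) /= -big_split /=.
pose d (x : 'I_n) := (x == i).
transitivity (koszul_parity e (+)
    (\big[addb/false]_(x < n) \big[addb/false]_(y < n) [&& x < y, s y < s x, d x & e (s y)]%N (+)
     \big[addb/false]_(x < n) \big[addb/false]_(y < n) [&& x < y, s y < s x, d y & e (s x)]%N)).
  rewrite /koszul_parity -!big_split /=; apply: eq_bigr => x _.
  rewrite -!big_split /=; apply: eq_bigr => y _; rewrite !sE -/(d x) -/(d y).
  have : ~~ [&& x < y, d x & d y]%N.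
    by apply/and3P => -[xy /eqP xi /eqP yi]; rewrite xi yi ltnn in xy.
  by move: (d x) (d y) (x < y)%N (s y < s x)%N (e _) (e _) => ? ? ? ? ? ?; bool_cases.
congr (_ (+) _).
rewrite [X in _ (+) X]exchange_big /= (bigD1 i) //= [X in _ (+) X](bigD1 i) //=.
rewrite [X in (_ (+) X) (+) _]big1 ?addbF => [|x /negbTE dx]; last first.
  by rewrite big1 // => y _; rewrite /d dx !andbF.
rewrite [X in _ (+) (_ (+) X)]big1 ?addbF => [|x /negbTE dx]; last first.
  by rewrite big1 // => y _; rewrite /d dx !andbF.
rewrite -big_split; apply: eq_bigr => y _ /=; rewrite /d eqxx nat_permE /=.
have [lt|lt|/val_inj ->] := ltngtP y i; rewrite ?ltnn //=; last first.
  by rewrite addbF.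
have : s y != s i :> nat by rewrite sE; apply: contraTneq lt => ->; rewrite ltnn.
by case: ltngtP => // _ _; case: e.
Qed.

End NatPerm.

Lemma koszul_parity1 n e : koszul_parity (1%g : 'S_n) e = false.
Proof.
apply: big1 => i _; apply: big1 => j _; rewrite !perm1.
by case: ltngtP.
Qed.

Lemma nat_perm1 n : nat_perm (1%g : 'S_n) =1 id.
Proof. by move=> x; rewrite /nat_perm; case: insubP => //= i _ <-; rewrite perm1. Qed.

Lemma nat_permM n (s t : 'S_n) x : nat_perm (s * t)%g x = nat_perm t (nat_perm s x).
Proof.
rewrite {1 3}/nat_perm; case: insubP => /= [i _ _|/negbTE h]; first by rewrite permM nat_permE.
by rewrite /nat_perm insubF.
Qed.

(** A pair is inverted by the product when exactly one of s and t inverts it (t at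
    the image of the pair under s). *)
Lemma koszul_parityM n (s t : 'S_n) (e : nat -> bool) :
  koszul_parity (s * t)%g e = koszul_parity t e (+) koszul_parity s (e \o nat_perm t).
Proof.
pose G (a b : 'I_n) : bool :=
  ((a < b) && (t b < t a) || (b < a) && (t a < t b))%N && (e (t a) && e (t b)).
have symG a b : G a b = G b a by rewrite /G orbC [e _ && _]andbC.
have -> : koszul_parity t e =
    \big[addb/false]_(i < n) \big[addb/false]_(j < n) ((i < j)%N && G i j).
  apply: eq_bigr => i _; apply: eq_bigr => j _; rewrite /G.
  by case: ltngtP; rewrite ?orbF.
rewrite -(sum_pairs_perm s symG) /koszul_parity -big_split; apply: eq_bigr => i _ /=.
rewrite -big_split; apply: eq_bigr => j _ /=; rewrite !permM !nat_permE /G.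
have [ij|//|//] := ltngtP i j; rewrite /=.
have ne : s i != s j by rewrite (inj_eq perm_inj) -(inj_eq val_inj) neq_ltn ij.
have : t (s i) != t (s j) :> nat by rewrite (inj_eq val_inj) (inj_eq perm_inj).
have : s i != s j :> nat by rewrite (inj_eq val_inj).
case: (e _); case: (e _); case: ltngtP => //= _; by case: ltngtP.
Qed.

Lemma cycle_permE n (i : 'I_n.+1) :
  cycle_perm n i = (if i < n then i.+1 else 0)%N :> nat.
Proof.
rewrite /cycle_perm permE /=; case: ltnP => h; first by rewrite modn_small.
have -> : nat_of_ord i = n by have := ltn_ord i; lia.
by rewrite modnn.
Qed.

Lemma nat_perm_cycle n x : (x < n)%N -> nat_perm (cycle_perm n) x = x.+1.
Proof.
move=> h; have h' : (x < n.+1)%N by lia.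
by rewrite -[x]/(nat_of_ord (Ordinal h')) nat_permE cycle_permE /= h.
Qed.

Lemma nat_perm_cycle_last n : nat_perm (cycle_perm n) n = 0%N.
Proof. by rewrite -[X in nat_perm _ X]/(nat_of_ord (@ord_max n)) nat_permE cycle_permE ltnn. Qed.

(** The cycle moves the first entry past all the others. *)
Lemma koszul_parity_cycle n (e : nat -> bool) :
  koszul_parity (cycle_perm n) e = e 0%N && psum (shift 1 e) n.
Proof.
rewrite /koszul_parity big_ord_recr /= [X in _ (+) X]big1 ?addbF => [|j _]; last first.
  by rewrite ltnNge -ltnS ltn_ord.
rewrite -psum_ord big_distrr /=; apply: eq_bigr => i _.
rewrite big_ord_recr /= big1 => [|j _]; last first.
  by rewrite !cycle_permE /= !ltn_ord ltnS; case: ltngtP.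
by rewrite !cycle_permE /= ltn_ord ltnn /= /shift add1n andbC.
Qed.

Section Lift.
Variables (n : nat) (s : 'S_n).
Let s' : 'S_n.+1 := lift_perm ord_max ord_max s.

Lemma lift_perm_widen (i : 'I_n) : s' (widen_ord (leqnSn n) i) = s i :> nat.
Proof.
have -> : widen_ord (leqnSn n) i = lift ord_max i.
  by apply: val_inj; rewrite /= /bump leqNgt ltn_ord.
by rewrite lift_perm_lift /= /bump leqNgt ltn_ord.
Qed.

Lemma nat_perm_lift x : nat_perm s' x = nat_perm s x.
Proof.
have [lt|gt|eq] := ltngtP x n.
- rewrite -[x]/(nat_of_ord (Ordinal lt)) nat_permE.
  rewrite -[nat_of_ord _]/(nat_of_ord (widen_ord (leqnSn n) (Ordinal lt))).
  by rewrite nat_permE lift_perm_widen.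
- by rewrite /nat_perm !insubF //; lia.
- rewrite {2}/nat_perm insubF ?eq ?ltnn //=.
  by rewrite -[X in nat_perm _ X]/(nat_of_ord (@ord_max n)) nat_permE lift_perm_id.
Qed.

Lemma koszul_parity_lift e : koszul_parity s' e = koszul_parity s e.
Proof.
rewrite /koszul_parity big_ord_recr /= [X in _ (+) X]big1 ?addbF => [|j _]; last first.
  by rewrite ltnNge -ltnS ltn_ord.
apply: eq_bigr => i _; rewrite big_ord_recr /= lift_perm_id lift_perm_widen /=.
rewrite [X in _ (+) (_ && X)]ifF ?andbF ?addbF; last by apply/negbTE; have := ltn_ord (s i); lia.
by apply: eq_bigr => j _; rewrite lift_perm_widen.
Qed.

End Lift.

(** The input of f o_i g that corresponds to the input j of f, for j different
    from i. *)
Definition outer (i n j : nat) : nat := if (j < i)%N then j else (j + n).-1.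

Lemma insert_block_outer T i n (u : nat -> T) w j : j != i ->
  insert_block i n u w j = u (outer i n j).
Proof. by rewrite /insert_block /outer => /negbTE ->; case: ifP. Qed.

Lemma insert_block_in T i n (u : nat -> T) w : insert_block i n u w i = w.
Proof. by rewrite /insert_block ltnn eqxx. Qed.

Lemma koszul_parity_nat n (s : 'S_n) e : koszul_parity s e =
  \big[addb/false]_(0 <= x < n) \big[addb/false]_(0 <= y < n)
    [&& x < y, nat_perm s y < nat_perm s x, e (nat_perm s x) & e (nat_perm s y)]%N.
Proof.
rewrite big_mkord; apply: eq_bigr => i _; rewrite big_mkord; apply: eq_bigr => j _.
by rewrite !nat_permE.
Qed.

(** Pairs of inputs inside the block count for t.  Between two different inputs of
    the outer map, a pair is inverted according to s alone, and summing over the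
    block replaces its entries by their total parity. *)
Lemma koszul_parity_block m n p (i : 'I_m) (s : 'S_m) (t : 'S_n) (r : 'S_p)
    (e : nat -> bool) : (m + n = p.+1)%N ->
  (forall l, (l < n)%N -> nat_perm r (i + l) = (s i + nat_perm t l)%N) ->
  (forall j, (j < m)%N -> j != i ->
     nat_perm r (outer i n j) = outer (s i) n (nat_perm s j)) ->
  koszul_parity r e = koszul_parity t (shift (s i) e) (+)
    koszul_parity s (insert_block (s i) n e (psum (shift (s i) e) n)).
Proof.
move=> E Hin Hout.
set G := psum _ n; set e' := insert_block _ _ _ _.
pose H x y := [&& x < y, nat_perm r y < nat_perm r x, e (nat_perm r x) & e (nat_perm r y)]%N.
pose K x y := [&& x < y, nat_perm s y < nat_perm s x, e' (nat_perm s x) & e' (nat_perm s y)]%N.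
have lim := ltn_ord i.
have si : s i = nat_perm s i :> nat by rewrite nat_permE.
have sinj j : (j < m)%N -> j != i -> nat_perm s j != s i.
  move=> lt; rewrite -[j]/(nat_of_ord (Ordinal lt)) nat_permE.
  by rewrite !(inj_eq val_inj) (inj_eq perm_inj).
have e'in : e' (s i) = G by rewrite /e' insert_block_in.
have e'out j : (j < m)%N -> j != i -> e' (nat_perm s j) = e (nat_perm r (outer i n j)).
  by move=> lt ne; rewrite /e' insert_block_outer ?sinj // Hout.
have GE : G = \big[addb/false]_(0 <= l < n) e (nat_perm r (i + l)).
  rewrite /G -(psum_perm t); apply: eq_big_nat => l /andP[_ lt].
  by rewrite Hin.
have Hoo j j' : (j < m)%N -> (j' < m)%N -> j != i -> j' != i ->
    H (outer i n j) (outer i n j') = K j j'.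
  move=> lj lj' nj nj'; rewrite /H /K !e'out // !Hout //.
  have := sinj _ lj nj; have := sinj _ lj' nj'.
  move: (nat_perm s j) (nat_perm s j') => a b na nb; rewrite /outer; congr [&& _, _, _ & _].
    by do 2 case: ifP => ?; lia.
  by do 2 case: ifP => ?; lia.
have Hoi j : (j < m)%N -> j != i ->
    \big[addb/false]_(0 <= l < n) H (outer i n j) (i + l)%N = K j i.
  move=> lj nj; rewrite /K -si e'in GE e'out // !andbA big_distrr /=.
  apply: eq_big_nat => l /andP[_ ll]; rewrite /H Hout // Hin // !andbA.
  have := sinj _ lj nj; move: (nat_perm s j) => a na.
  have := nat_perm_lt t ll; move: (nat_perm t l) => b lb.
  congr (_ && _ && _ && _); rewrite /outer; case: ifP => ?; lia.
have Hio j : (j < m)%N -> j != i ->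
    \big[addb/false]_(0 <= l < n) H (i + l)%N (outer i n j) = K i j.
  move=> lj nj; rewrite /K -si e'in GE e'out // [_ && e _]andbC !andbA big_distrr /=.
  apply: eq_big_nat => l /andP[_ ll].
  rewrite /H Hout // Hin // [e (_ + _) && _]andbC !andbA.
  have := sinj _ lj nj; move: (nat_perm s j) => a na.
  have := nat_perm_lt t ll; move: (nat_perm t l) => b lb.
  congr (_ && _ && _ && _); rewrite /outer; case: ifP => ?; lia.
have Hii : \big[addb/false]_(0 <= l < n) \big[addb/false]_(0 <= l' < n)
    H (i + l)%N (i + l')%N = koszul_parity t (shift (s i) e).
  rewrite koszul_parity_nat; apply: eq_big_nat => l /andP[_ ll].
  by apply: eq_big_nat => l' /andP[_ ll']; rewrite /H !Hin // !ltn_add2l.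
have Kii : K i i = false by rewrite /K ltnn.
rewrite [LHS](_ : _ = \big[addb/false]_(0 <= x < p) \big[addb/false]_(0 <= y < p) H x y);
  last exact: koszul_parity_nat.
rewrite (big_insert_block _ _ E lim).
rewrite [X in _ (+) X]koszul_parity_nat -(sum_delta (koszul_parity t _) lim) -big_split.
apply: eq_big_nat => j /andP[_ lj] /=.
have [->|nj] := eqVneq j i; last first.
  rewrite insert_block_outer //= (big_insert_block _ _ E lim); apply: eq_big_nat => j' /andP[_ lj'].
  have [->|nj'] := eqVneq j' i; first by rewrite insert_block_in Hoi.
  by rewrite insert_block_outer // Hoo.
rewrite insert_block_in /=.
under eq_bigr do rewrite (big_insert_block _ _ E lim).
rewrite exchange_big /= -(sum_delta (koszul_parity t _) lim) -big_split.
apply: eq_big_nat => j' /andP[_ lj'] /=.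
have [->|nj'] := eqVneq j' i.
  by under eq_bigr do rewrite insert_block_in; rewrite Hii -/(K i i) Kii addbF.
by under eq_bigr do rewrite insert_block_outer //; rewrite Hio.
Qed.

(** * Multilinear maps on homogeneous families *)

Section Graded.
Variables (k : fieldType) (V : dgModType k).
Implicit Types (a b : bool).

Lemma gpr_gpr a b (v : V) : gpr V a (gpr V b v) = if a == b then gpr V b v else 0.
Proof. exact: gproj_proj. Qed.

Lemma homog_gpr b (v : V) : homog b (gpr V b v).
Proof. by rewrite /homog gpr_gpr eqxx. Qed.

Lemma gpr_homog a b (v : V) : homog b v -> gpr V a v = if a == b then v else 0.
Proof. by move=> <-; rewrite gpr_gpr. Qed.

Lemma gpr_sum (v : V) : gpr V false v + gpr V true v = v.
Proof. exact: gproj_sum. Qed.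

Lemma homog0 b : homog b (0 : V).
Proof. exact: linear0. Qed.

Lemma homogZ b (x : k) (v : V) : homog b v -> homog b (x *: v).
Proof. by rewrite /homog linearZ /= => ->. Qed.

Lemma homogD b (v w : V) : homog b v -> homog b w -> homog b (v + w).
Proof. by rewrite /homog linearD /= => -> ->. Qed.

Lemma homog_diff b (v : V) : homog b v -> homog (~~ b) (diff V v).
Proof. by rewrite /homog => {2}<-; rewrite /diff dgd_odd. Qed.

Lemma diff_diff (v : V) : diff V (diff V v) = 0.
Proof. exact: dgd_dgd. Qed.

Lemma tw_linear b : linear (tw (V := V) b).
Proof.
move=> x v w; rewrite /tw !linearP /= !scalerDr !scalerA mulrC.
by rewrite addrACA.
Qed.

Lemma tw_homog b (c : bool) (v : V) : homog c v -> tw b v = (-1) ^+ (b && c) *: v.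
Proof.
move=> h; rewrite /tw !(gpr_homog _ h); case: c h => h; rewrite ?andbT ?andbF.
  by rewrite add0r.
by rewrite scaler0 addr0 scale1r.
Qed.

Definition hfam (e : nat -> bool) (u : nat -> V) : Prop := forall j, homog (e j) (u j).

Definition update (u : nat -> V) (i : nat) (x : V) : nat -> V :=
  fun j => if j == i then x else u j.

Lemma slotE p (v : 'I_p -> V) (j : 'I_p) : slot v j = v j.
Proof. by rewrite /slot valK. Qed.

Lemma slot_restrict p (u : nat -> V) x : (x < p)%N -> slot (fun j : 'I_p => u j) x = u x.
Proof. by move=> lt; rewrite -[x]/(nat_of_ord (Ordinal lt)) slotE. Qed.

(** The relational form of linearity in the i-th variable: it avoids rewriting
    families of vectors as explicit updates of one another. *)
Definition lin_at n (i : 'I_n) (c : k) (u v w : 'I_n -> V) : Prop :=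
  u i = c *: v i + w i /\ forall j, j != i -> v j = u j /\ w j = u j.

Lemma lin_at_slot n (i : 'I_n) (c : k) (u v w : 'I_n -> V) : lin_at i c u v w ->
  slot u i = c *: slot v i + slot w i /\
  forall x : nat, x != i -> slot v x = slot u x /\ slot w x = slot u x.
Proof.
case=> E H; split=> [|x]; first by rewrite !slotE.
by rewrite /slot; case: insubP => //= j _ <- ne; apply: H.
Qed.

Lemma multilinearE (W : lmodType k) n (f : ('I_n -> V) -> W) : multilinear f <->
  forall (i : 'I_n) (c : k) (u v w : 'I_n -> V), lin_at i c u v w -> f u = c *: f v + f w.
Proof.
split=> [ml i c u v w [E H]|H v i c x y].
  have := ml u i c (v i) (w i); rewrite -E; congr (_ = c *: _ + _).
  - congr f; apply: funext => j /=; by case: eqP => // ->.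
  - by congr f; apply: funext => j /=; case: eqVneq => [->|/H[]].
  - by congr f; apply: funext => j /=; case: eqVneq => [->|/H[]].
apply: (H i); split=> [|j /negbTE ne]; first by rewrite /= eqxx.
by rewrite /= ne.
Qed.

Section Maps.
Variables (W : lmodType k) (n : nat).
Implicit Types (f g : ('I_n -> V) -> W).

Lemma mlD f g : multilinear f -> multilinear g -> multilinear (f + g).
Proof.
move=> /multilinearE hf /multilinearE hg; apply/multilinearE => i c u v w H.
have E x : (f + g) x = f x + g x by [].
by rewrite !E (hf _ _ _ _ _ H) (hg _ _ _ _ _ H) scalerDr addrACA.
Qed.

Lemma mlZ (x : k) f : multilinear f -> multilinear (x *: f).
Proof.
move=> /multilinearE hf; apply/multilinearE => i c u v w H.
have E z : (x *: f) z = x *: f z by [].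
by rewrite !E (hf _ _ _ _ _ H) scalerDr !scalerA mulrC.
Qed.

Lemma ml_sum I r (P : pred I) (F : I -> ('I_n -> V) -> W) :
  (forall i, multilinear (F i)) -> multilinear (fun v => \sum_(i <- r | P i) F i v).
Proof.
move=> hF; apply/multilinearE => i c u v w H; rewrite scaler_sumr -big_split.
by apply: eq_bigr => j _; move/multilinearE: (hF j) => /(_ _ _ _ _ _ H).
Qed.

Lemma ml_precomp f (L : 'I_n -> V -> V) (s : 'S_n) : multilinear f ->
  (forall j, linear (L j)) -> multilinear (fun v => f (fun j => L j (v (s j)))).
Proof.
move=> /multilinearE hf hL; apply/multilinearE => i c u v w [E H].
apply: (hf (s^-1 i)%g); split=> [|j ne]; first by rewrite permKV E hL.
have /H[-> -> //] : s j != i.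
by apply: contraNneq ne => <-; rewrite permK.
Qed.

Lemma ml_postcomp (W' : lmodType k) f (h : {linear W -> W'}) :
  multilinear f -> multilinear (fun v => h (f v)).
Proof.
move=> /multilinearE hf; apply/multilinearE => i c u v w H.
by rewrite (hf _ _ _ _ _ H) linearP.
Qed.

Lemma ml_perm_act (s : 'S_n) f : multilinear f -> multilinear (perm_act s f).
Proof.
move=> hf; apply: ml_sum => e; apply: (@mlZ _ (fun v => f _)).
apply: (@ml_precomp f (fun i => gpr V (e (s i)))) => // j.
exact: linearP.
Qed.

(** Evaluation on the first n members of a sequence. *)
Definition ev f (u : nat -> V) : W := f (fun j : 'I_n => u j).

Lemma ev_slot f v : ev f (slot v) = f v.
Proof. by congr f; apply: funext => j; rewrite slotE. Qed.

Lemma eq_ev f u u' : (forall j, (j < n)%N -> u j = u' j) -> ev f u = ev f u'.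
Proof. by move=> E; congr f; apply: funext => j; apply: E. Qed.

Lemma ev_update f u i (c : k) x y : multilinear f -> (i < n)%N ->
  ev f (update u i (c *: x + y)) = c *: ev f (update u i x) + ev f (update u i y).
Proof.
move=> /multilinearE hf lt; apply: (hf (Ordinal lt)).
split; rewrite /update /= ?eqxx // => j ne.
by have -> : (j == i :> nat) = false by apply/negbTE; rewrite -(inj_eq val_inj) in ne.
Qed.

Lemma update_id u i j : update u i (u i) j = u j.
Proof. by rewrite /update; case: eqP => // ->. Qed.

Lemma ev_updateZ f u i (c : k) x : multilinear f -> (i < n)%N ->
  ev f (update u i (c *: x)) = c *: ev f (update u i x).
Proof.
move=> hf lt.
have ev0 : ev f (update u i 0) = 0.
  have := ev_update u (-1) 0 0 hf lt; rewrite scaler0 addr0 scaleN1r => /eqP.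
  by rewrite addrC subrr => /eqP.
by rewrite -{1}[c *: x]addr0 ev_update // ev0 addr0.
Qed.

Lemma ev0 f u i : multilinear f -> (i < n)%N -> u i = 0 -> ev f u = 0.
Proof.
move=> hf lt E; have := @ev_updateZ f u i 0 (u i) hf lt; rewrite !scale0r => <-.
by apply: eq_ev => j _; rewrite -[in RHS]E update_id.
Qed.

(** By induction on i, two maps that agree on homogeneous families agree on
    families whose entries are homogeneous from position i on: split the entry
    i into its even and odd parts. *)
Lemma ev_ext f g : multilinear f -> multilinear g ->
  (forall e u, hfam e u -> ev f u = ev g u) -> f = g.
Proof.
move=> hf hg H; apply: funext => v; rewrite -!(ev_slot _ v).
suff main i : (i <= n)%N -> forall u, (forall j, (i <= j)%N -> exists b, homog b (u j)) ->
    ev f u = ev g u.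
  apply: (main n) => // j le; exists false; rewrite /slot insubF; first exact: homog0.
  by apply/negbTE; rewrite -leqNgt.
elim: i => [_ u hu|i IH lt u hu].
  have /choice[e he] : forall j, exists b, homog b (u j) by move=> j; apply: hu.
  exact: (H e).
have E h : multilinear h -> ev h u =
    ev h (update u i (gpr V false (u i))) + ev h (update u i (gpr V true (u i))).
  move=> hh; rewrite -[X in _ = X + _]scale1r -ev_update // scale1r gpr_sum.
  by apply: eq_ev => j _; rewrite update_id.
have hu' b : forall j, (i <= j)%N -> exists b', homog b' (update u i (gpr V b (u i)) j).
  move=> j le; rewrite /update; case: eqP => [_|ne]; first by exists b; apply: homog_gpr.
  by apply: hu; lia.
have IH' := IH (ltnW lt); rewrite (E f) // (E g) //.
by rewrite (IH' _ (hu' false)) (IH' _ (hu' true)).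
Qed.

(** The sign of moving a symbol of parity b past the first i entries. *)
Lemma ev_tw f b i e u u' : multilinear f -> (i <= n)%N ->
  (forall j, (j < i)%N -> homog (e j) (u j)) ->
  ev f (fun j => if (j < i)%N then tw b (u j) else u' j) =
    (-1) ^+ (b && psum e i) *: ev f (fun j => if (j < i)%N then u j else u' j).
Proof.
move=> hf; elim: i u' => [|i IH] u' le hu; first by rewrite psum0 andbF scale1r.
have hui := hu i (ltnSn i).
rewrite psumS andb_addr signr_addb -scalerA -[X in _ = _ *: X]/(_ *: _).
transitivity (ev f (fun j => if (j < i)%N then tw b (u j)
                else update u' i (tw b (u i)) j)).
  apply: eq_ev => j _; rewrite /update ltnS leq_eqVlt; case: eqP => [->|_] //=.
  by rewrite ltnn.
rewrite IH ?(ltnW le) // => [|j lt]; last exact/hu/ltnW.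
congr (_ *: _); rewrite (tw_homog _ hui).
transitivity (ev f (update (fun j => if (j < i.+1)%N then u j else u' j) i ((-1) ^+ (b && e i) *: u i))).
  apply: eq_ev => j _; rewrite /update; case: eqP => [->|ne]; first by rewrite ltnn.
  by rewrite (_ : (j < i.+1)%N = (j < i)%N) //; lia.
rewrite ev_updateZ //; congr (_ *: _); apply: eq_ev => j _.
by rewrite /update; case: eqP => // ->; rewrite ltnSn.
Qed.

(** In the sum over parity patterns that defines the action, only the pattern of
    the given family contributes: for any other pattern some argument vanishes. *)
Lemma ev_perm_act (s : 'S_n) f e u : multilinear f -> hfam e u ->
  ev (perm_act s f) u = (-1) ^+ koszul_parity s e *: ev f (u \o nat_perm s).
Proof.
move=> hf hu; rewrite {1}/ev /perm_act (bigD1 [ffun i : 'I_n => e i]) //=.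
rewrite big1 ?addr0 => [|e' ne].
  congr (_ *: _); first by apply: koszul_signE => i; rewrite ffunE.
  by congr f; apply: funext => i; rewrite ffunE /= nat_permE; apply: hu.
have [i ni] : exists i : 'I_n, e' i != e i.
  apply/existsP; apply: contraNT ne; rewrite negb_exists => /forallP E.
  by apply/eqP/ffunP => i; rewrite ffunE; apply/eqP; have := E i; rewrite negbK.
set w : 'I_n -> V := (X in f X); have wi : w (s^-1 i)%g = 0.
  by rewrite /w permKV (gpr_homog _ (hu i)) (negbTE ni).
by rewrite -ev_slot (@ev0 f _ (s^-1 i)%g) ?scaler0 // slotE.
Qed.

End Maps.

Lemma perm_actM (W : lmodType k) n (s t : 'S_n) (f : ('I_n -> V) -> W) : multilinear f ->
  perm_act (s * t)%g f = perm_act t (perm_act s f).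
Proof.
move=> hf; have hs := ml_perm_act s hf; apply: ev_ext; try exact: ml_perm_act.
move=> e u hu; rewrite (ev_perm_act _ hf hu) (ev_perm_act _ hs hu).
rewrite (@ev_perm_act _ _ _ _ (e \o nat_perm t)) // => [|j]; last exact: hu.
rewrite koszul_parityM signr_addb scalerA; congr (_ *: _).
by apply: eq_ev => j _ /=; rewrite nat_permM.
Qed.

Lemma perm_act1 (W : lmodType k) n (f : ('I_n -> V) -> W) : multilinear f ->
  perm_act 1%g f = f.
Proof.
move=> hf; apply: ev_ext => // [|e u hu]; first exact: ml_perm_act.
rewrite (ev_perm_act _ _ hu) // koszul_parity1 scale1r.
by apply: eq_ev => j _ /=; rewrite nat_perm1.
Qed.

End Graded.

(** * The grading and the differential of multilinear maps *)

Section HomogeneousMaps.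
Variables (k : fieldType) (V : dgModType k).
Implicit Types (a b : bool).
Local Notation multimap n := (('I_n -> V) -> V).

(** Antisymmetry alone makes the diagonal vanish only where 2 is invertible. *)
Lemma sum_antisym (W : zmodType) n (F : nat -> nat -> W) :
  (forall i, (i < n)%N -> F i i = 0) ->
  (forall i j, (i < j)%N -> (j < n)%N -> F i j = - F j i) ->
  \sum_(0 <= i < n) \sum_(0 <= j < n) F i j = 0.
Proof.
elim: n => [|n IH] F0 FN; first by rewrite big_geq.
rewrite big_nat_recr //= big_nat_recr //= F0 // addr0.
under eq_bigr do rewrite big_nat_recr //=.
rewrite big_split /= IH => [|i lt|i j lt lt']; [|by apply: F0; lia|by apply: FN; lia].
rewrite add0r -big_split big_nat big1 // => i /andP[_ lt] /=.
by rewrite FN // addNr.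
Qed.

Lemma ml_map (W : lmodType k) n (f : ('I_n -> V) -> W) (L : 'I_n -> V -> V) :
  multilinear f -> (forall j, linear (L j)) -> multilinear (fun v => f (fun j => L j (v j))).
Proof.
move=> hf hL; have := ml_precomp 1%g hf hL; congr multilinear; apply: funext => v.
by congr f; apply: funext => j; rewrite perm1.
Qed.

Lemma homog_sum b I r (P : pred I) (F : I -> V) :
  (forall i, P i -> homog b (F i)) -> homog b (\sum_(i <- r | P i) F i).
Proof. by move=> H; elim/big_ind: _ => //; [exact: homog0|exact: homogD]. Qed.

Lemma homogB b (v w : V) : homog b v -> homog b w -> homog b (v - w).
Proof. by move=> hv hw; apply: homogD => //; rewrite -scaleN1r; apply: homogZ. Qed.

Section Grading.
Variable n : nat.
Implicit Types (f g : multimap n).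

Lemma endo_gprP b (c : k) f g : endo_gpr b (c *: f + g) = c *: endo_gpr b f + endo_gpr b g.
Proof.
apply: funext => v; rewrite -[RHS]/(c *: endo_gpr b f v + endo_gpr b g v).
rewrite /endo_gpr scaler_sumr -big_split; apply: eq_bigr => e _ /=.
by rewrite -linearP.
Qed.

Lemma ml_endo_gpr b f : multilinear f -> multilinear (endo_gpr b f).
Proof.
move=> hf; apply: ml_sum => e; apply: (ml_postcomp (gpr V _)); apply: (ml_map (L := fun i => gpr V (e i))) => // j.
exact: linearP.
Qed.

Lemma ev_endo_gpr b f e u : multilinear f -> hfam e u ->
  ev (endo_gpr b f) u = gpr V (b (+) psum e n) (ev f u).
Proof.
move=> hf hu; rewrite {1}/ev /endo_gpr (bigD1 [ffun i : 'I_n => e i]) //=.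
rewrite [X in _ + X]big1 ?addr0 => [|e' ne].
  have -> : \big[addb/false]_(i < n) [ffun i : 'I_n => e i] i = psum e n.
    by rewrite -psum_ord; apply: eq_bigr => i _; rewrite ffunE.
  congr (gpr V _ _).
  by congr f; apply: funext => i; rewrite ffunE; apply: hu.
have [i ni] : exists i : 'I_n, e' i != e i.
  apply/existsP; apply: contraNT ne; rewrite negb_exists => /forallP E.
  by apply/eqP/ffunP => i; rewrite ffunE; apply/eqP; have := E i; rewrite negbK.
set w : 'I_n -> V := (X in f X); have wi : w i = 0.
  by rewrite /w (gpr_homog _ (hu i)) (negbTE ni).
by rewrite -ev_slot (@ev0 _ _ _ _ f _ i) ?linear0 // slotE.
Qed.

(** Homogeneity of a multilinear map as an element of Hom(V^(x)n, V). *)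
Definition hdeg b f : Prop := endo_gpr b f = f.

Lemma hdeg_ev b f e u : multilinear f -> hdeg b f -> hfam e u ->
  homog (b (+) psum e n) (ev f u).
Proof. by move=> hf hb hu; rewrite -{1}hb (ev_endo_gpr _ hf hu); apply: homog_gpr. Qed.

Lemma hdegP b f : multilinear f ->
  (forall e u, hfam e u -> homog (b (+) psum e n) (ev f u)) -> hdeg b f.
Proof.
move=> hf H; apply: ev_ext => // [|e u hu]; first exact: ml_endo_gpr.
by rewrite (ev_endo_gpr _ hf hu); apply: H.
Qed.

Lemma endo_gpr_gpr a b f : multilinear f ->
  endo_gpr a (endo_gpr b f) = if a == b then endo_gpr b f else 0.
Proof.
move=> hf; have hb := ml_endo_gpr b hf; apply: ev_ext; first exact: ml_endo_gpr.
  by case: eqP => // _; apply: multilinear0.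
move=> e u hu; rewrite (ev_endo_gpr _ hb hu) (ev_endo_gpr _ hf hu) gpr_gpr.
rewrite (inj_eq (@addIb (psum e n))); case: eqP => // _.
by rewrite (ev_endo_gpr _ hf hu).
Qed.

Lemma hdeg_gpr b f : multilinear f -> hdeg b (endo_gpr b f).
Proof. by move=> hf; rewrite /hdeg endo_gpr_gpr // eqxx. Qed.

Lemma endo_gpr_hdeg a b f : multilinear f -> hdeg b f ->
  endo_gpr a f = if a == b then f else 0.
Proof. by move=> hf hb; rewrite -{1}hb endo_gpr_gpr // hb. Qed.

Lemma endo_gpr_sum f : multilinear f -> endo_gpr false f + endo_gpr true f = f.
Proof.
move=> hf; apply: ev_ext => //; first by apply: mlD; apply: ml_endo_gpr.
move=> e u hu; rewrite -[LHS]/(ev (endo_gpr false f) u + ev (endo_gpr true f) u).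
rewrite !(ev_endo_gpr _ hf hu); case: psum; last exact: gpr_sum.
by rewrite addrC gpr_sum.
Qed.

(** Every multilinear map is the sum of its even and its odd part, so additive
    properties need only be proved for homogeneous maps. *)
Lemma hdeg_ind (P : multimap n -> Prop) :
  (forall g h, P g -> P h -> P (g + h)) ->
  (forall b g, multilinear g -> hdeg b g -> P g) ->
  forall f, multilinear f -> P f.
Proof.
move=> PD Ph f hf; rewrite -(endo_gpr_sum hf).
by apply: PD; apply: Ph; [exact: ml_endo_gpr|exact: hdeg_gpr|exact: ml_endo_gpr|exact: hdeg_gpr].
Qed.

(** The parities of a family after d has been applied to its i-th entry; the form
    of the body is the one of [koszul_parity_flip]. *)
Definition flip (e : nat -> bool) (i : nat) : nat -> bool :=
  fun x => e x (+) (true && (x == i)).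

Lemma psum_flip e i j : psum (flip e i) j = psum e j (+) (i < j)%N.
Proof.
elim: j => [|j IH]; first by rewrite !psum0.
rewrite !psumS IH /flip ltnS [(i <= j)%N]leq_eqVlt [j == i]eq_sym; case: eqP => [->|_] /=.
  by rewrite ltnn !addbT addbF addbN.
by rewrite addbF -!addbA [(_ < _)%N (+) _]addbC.
Qed.

Definition dupdate (u : nat -> V) (i : nat) : nat -> V := update u i (diff V (u i)).

Lemma hfam_dupdate e u i : hfam e u -> hfam (flip e i) (dupdate u i).
Proof.
move=> hu j; rewrite /flip /dupdate /update; case: eqP => [->|_].
  by rewrite addbT; apply: homog_diff.
by rewrite addbF.
Qed.

Lemma endo_diffP (c : k) f g : endo_diff (c *: f + g) = c *: endo_diff f + endo_diff g.
Proof.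
apply: funext => v; rewrite -[RHS]/(c *: endo_diff f v + endo_diff g v).
rewrite /endo_diff -[(c *: f + g) v]/(c *: f v + g v) linearP /= scalerBr.
rewrite addrACA -opprD; congr (_ - _); rewrite scaler_sumr -big_split.
apply: eq_bigr => b _ /=; rewrite scaler_sumr -big_split; apply: eq_bigr => i _ /=.
by rewrite endo_gprP -[(_ + _) _]/(c *: endo_gpr b f _ + endo_gpr b g _) scalerDr !scalerA mulrC.
Qed.

Lemma ml_endo_diff f : multilinear f -> multilinear (endo_diff f).
Proof.
move=> hf; apply: mlD; first exact: (ml_postcomp (diff V)).
pose F b (i : 'I_n) : multimap n := fun v => endo_gpr b f
      (fun j => if (j < i)%N then tw true (v j)
                else if j == i then diff V (v j) else v j).
have hF b i : multilinear (F b i).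
  apply: (@ml_map _ _ _ (fun j v => if (j < i)%N then tw true v else if j == i then diff V v else v)).
    exact: ml_endo_gpr.
  move=> j c v w; case: ifP => _; first by rewrite tw_linear.
  by case: ifP => _ //; rewrite linearP.
have : multilinear (-1 *: (fun v => \sum_(b : bool) \sum_(i < n) (-1) ^+ b *: F b i v)).
  apply: mlZ; apply: ml_sum => b; apply: ml_sum => i; exact: mlZ.
by congr multilinear; apply: funext => v; exact: scaleN1r.
Qed.

Lemma ev_endo_diff a f e u : multilinear f -> hdeg a f -> hfam e u ->
  ev (endo_diff f) u = diff V (ev f u) -
    \sum_(0 <= i < n) (-1) ^+ (a (+) psum e i) *: ev f (dupdate u i).
Proof.
move=> hf ha hu; rewrite {1}/ev /endo_diff; congr (_ - _).
rewrite (bigD1 a) //= [X in _ + X]big1 ?addr0 => [|b /negbTE ne]; last first.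
  by rewrite big1 // => i _; rewrite (endo_gpr_hdeg _ hf ha) ne scaler0.
rewrite big_mkord ha; apply: eq_bigr => i _; rewrite signr_addb -scalerA; congr (_ *: _).
have le := ltnW (ltn_ord i).
rewrite -[RHS]/((-1) ^+ (true && psum e i) *: _).
have -> : ev f (dupdate u i) = ev f (fun j => if (j < i)%N then u j else dupdate u i j).
  apply: eq_ev => j _; rewrite /dupdate /update; case: eqP => [->|_]; first by rewrite ltnn.
  by rewrite if_same.
rewrite -ev_tw //.
congr f; apply: funext => j; case: ifP => // _; rewrite /dupdate /update.
by rewrite -(inj_eq val_inj) /=; case: eqP => // ->.
Qed.

Lemma hdeg_endo_diff a f : multilinear f -> hdeg a f -> hdeg (~~ a) (endo_diff f).
Proof.
move=> hf ha; apply: hdegP => [|e u hu]; first exact: ml_endo_diff.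
rewrite (ev_endo_diff hf ha hu); apply: homogB.
  by rewrite addNb; apply: homog_diff; apply: hdeg_ev.
rewrite big_nat; apply: homog_sum => i /andP[_ lt]; apply: homogZ.
have := hdeg_ev hf ha (hfam_dupdate i hu); rewrite psum_flip lt addbT addNb -addbN.
by rewrite addbN.
Qed.

Lemma endo_diff0 : endo_diff (0 : multimap n) = 0.
Proof. by have := endo_diffP (-1) 0 0; rewrite scaler0 addr0 scaleN1r addNr. Qed.

Lemma endo_diffD f g : endo_diff (f + g) = endo_diff f + endo_diff g.
Proof. by have := endo_diffP 1 f g; rewrite !scale1r. Qed.

Lemma endo_gprD b f g : endo_gpr b (f + g) = endo_gpr b f + endo_gpr b g.
Proof. by have := endo_gprP b 1 f g; rewrite !scale1r. Qed.

Lemma endo_diff_gpr b f : multilinear f ->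
  endo_diff (endo_gpr b f) = endo_gpr (~~ b) (endo_diff f).
Proof.
move: f; apply: hdeg_ind => [g h Eg Eh|a g hg ha].
  by rewrite endo_gprD endo_diffD (endo_diffD g h) endo_gprD Eg Eh.
rewrite (endo_gpr_hdeg _ hg ha) (endo_gpr_hdeg _ (ml_endo_diff hg) (hdeg_endo_diff hg ha)).
by rewrite (inj_eq negb_inj); case: eqP => // _; exact: endo_diff0.
Qed.

(** The terms in which d acts twice on the output or on one input vanish since
    d d = 0.  Those with d on the output and on one input occur twice, with
    opposite signs since d f has the other parity than f.  Those with d on two
    inputs i < j cancel because applying d first at i changes the sign at j. *)
Lemma endo_diff_diff f : multilinear f -> endo_diff (endo_diff f) = 0.
Proof.
move: f; apply: hdeg_ind => [g h Eg Eh|a f hf ha].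
  by rewrite (endo_diffD g h) (endo_diffD (endo_diff g)) Eg Eh addr0.
have hd := ml_endo_diff hf; apply: ev_ext; [exact: ml_endo_diff|exact: multilinear0|].
move=> e u hu; rewrite (ev_endo_diff hd (hdeg_endo_diff hf ha) hu) (ev_endo_diff hf ha hu).
rewrite linearB /= diff_diff sub0r linear_sum /= -opprD; apply/eqP; rewrite oppr_eq0; apply/eqP.
pose S i j : V := (-1) ^+ (psum e i (+) psum (flip e i) j) *: ev f (dupdate (dupdate u i) j).
transitivity (\sum_(0 <= i < n) \sum_(0 <= j < n) S i j).
  rewrite -big_split; apply: eq_bigr => i _ /=.
  rewrite (ev_endo_diff hf ha (hfam_dupdate i hu)) linearZ /= scalerBr addrA.
  rewrite addNb -scalerDl signrN addrN scale0r sub0r scaler_sumr -sumrN.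
  apply: eq_bigr => j _; rewrite scaleNr opprK scalerA -signr_addb; congr (_ ^+ _ *: _).
  by bool_cases.
apply: sum_antisym => [i lt|i j ij lt].
  rewrite /S [ev f _](@ev0 _ _ _ _ f _ i) ?scaler0 //.
  by rewrite /dupdate /update !eqxx diff_diff.
rewrite /S -scaleNr; congr (_ *: _).
  rewrite !psum_flip ij (ltnNge j i) (ltnW ij) /= -signrN; congr (_ ^+ _).
  by bool_cases.
apply: eq_ev => x _; rewrite /dupdate /update.
rewrite (ltn_eqF ij) (gtn_eqF ij); case: (eqVneq x i) => [->|_] //.
by rewrite (ltn_eqF ij).
Qed.

End Grading.

End HomogeneousMaps.

(** * Partial compositions *)

Section PartialComposition.
Variables (k : fieldType) (V : dgModType k).
Implicit Types (a b : bool).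
Local Notation multimap n := (('I_n -> V) -> V).

Lemma hfam_shift e u i : hfam e u -> hfam (V := V) (shift i e) (shift i u).
Proof. by move=> hu j; apply: hu. Qed.

Lemma hfam_insert e u i n c (w : V) : hfam e u -> homog c w ->
  hfam (insert_block i n e c) (insert_block i n u w).
Proof.
move=> hu hw j; rewrite /insert_block.
by case: ifP => _; [|case: ifP => _].
Qed.

Lemma ev_insertP m n i (f : multimap m) u (c : k) x y : multilinear f -> (i < m)%N ->
  ev f (insert_block i n u (c *: x + y)) =
  c *: ev f (insert_block i n u x) + ev f (insert_block i n u y).
Proof.
move=> hf lt.
have E w : ev f (insert_block i n u w) = ev f (update (insert_block i n u 0) i w).
  apply: eq_ev => j _; rewrite /update /insert_block.
  by case: eqP => [->|]; rewrite ?ltnn.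
by rewrite !E ev_update.
Qed.

(** The value of f at w in the i-th input, as a function of w. *)
Definition plug m n i (f : multimap m) (u : nat -> V) (w : V) : V := ev f (insert_block i n u w).

Lemma plugP m n i (f : multimap m) u : multilinear f -> (i < m)%N -> linear (plug n i f u).
Proof. by move=> hf lt c x y; apply: ev_insertP. Qed.

(* For functions such as [plug] that are linear only under hypotheses on their
   parameters. *)
Section LinearProp.
Variables (h : V -> V) (hh : linear h).

Lemma lin0 : h 0 = 0.
Proof. by have := hh (-1) 0 0; rewrite scaler0 addr0 !scaleN1r addNr. Qed.

Lemma linZ (c : k) v : h (c *: v) = c *: h v.
Proof. by have := hh c v 0; rewrite lin0 !addr0. Qed.

Lemma linD v w : h (v + w) = h v + h w.
Proof. by have := hh 1 v w; rewrite !scale1r. Qed.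

Lemma linB v w : h (v - w) = h v - h w.
Proof. by rewrite linD -scaleN1r linZ scaleN1r. Qed.

Lemma lin_sum I r (P : pred I) F : h (\sum_(i <- r | P i) F i) = \sum_(i <- r | P i) h (F i).
Proof. exact: (big_morph h linD lin0). Qed.

End LinearProp.

Section Comp.
Variables (m n p : nat) (E : (m + n = p.+1)%N).
Implicit Types (i : 'I_m) (f : multimap m) (g : multimap n).
Local Notation comp i f g := (endo_comp i f g : multimap p).

(** An entry x of the family lies before, inside or after the block of g, and
    accordingly enters the input x of f, the input i of f through g, or the
    input x - n + 1 of f. *)
Lemma ml_endo_comp i f g : multilinear f -> multilinear g -> multilinear (comp i f g).
Proof.
move=> hf hg.
apply: (@ml_sum _ _ _ _ _ _ _ (fun b v => f (fun j => if (j < i)%N then tw b (slot v j)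
              else if j == i then endo_gpr b g (fun l => slot v (i + l))
              else slot v (j + n).-1))) => b.
have := ml_endo_gpr b hg; move: (endo_gpr b g) => {hg}g /multilinearE hg.
move/multilinearE: hf => hf.
apply/multilinearE => x c u v w /lin_at_slot [Ex Hx].
have lim := ltn_ord i; have lx := ltn_ord x.
have [lt|ge] := ltnP x i.
  have xm : (x < m)%N by lia.
  apply: (hf (Ordinal xm)); split=> [|j ne] /=.
    by rewrite lt Ex tw_linear.
  have nj : j != x :> nat by rewrite -(inj_eq val_inj) in ne.
  have [-> ->] := Hx _ nj; case: ifP => // ji.
  have Hl (y : nat) : y != x -> slot v y = slot u y /\ slot w y = slot u y by exact: Hx.
  case: ifP => [/eqP _|jni]; last by apply: Hl; rewrite -(inj_eq val_inj) /= in jni; lia.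
  by split; congr g; apply: funext => l; apply Hx; lia.
have [lt|ge'] := ltnP x (i + n).
  apply: (hf i); split=> [|j ne] /=.
    rewrite ltnn eqxx; have xn : (x - i < n)%N by lia.
    apply: (hg (Ordinal xn)); split=> /= [|l]; first by rewrite subnKC.
    by rewrite -(inj_eq val_inj) /= => ne; apply: Hx; lia.
  have ne' : j != i :> nat by [].
  rewrite (negbTE ne); have := ltn_ord j => lj.
  have Hj (y : nat) : y != x -> slot v y = slot u y /\ slot w y = slot u y by exact: Hx.
  by case: ifP => ji; [have [-> ->] := Hj j ltac:(lia)|apply: Hj; lia].
have xm : (x - n < m.-1)%N by lia.
have xm' : ((x - n).+1 < m)%N by lia.
apply: (hf (Ordinal xm')); split=> [|j ne] /=.
  have b1 : ((x - n).+1 < i)%N = false by lia.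
  have b2 : ((x - n).+1 == i)%N = false by lia.
  rewrite b1 -(inj_eq val_inj) /= b2.
  by rewrite subnK ?Ex //; lia.
rewrite -(inj_eq val_inj) /= in ne.
case: ifP => ji; first by have [-> ->] : slot v j = slot u j /\ slot w j = slot u j by apply: Hx; lia.
case: ifP => [_|]; last by rewrite -(inj_eq val_inj) /= => jni; apply: Hx; have := ltn_ord j; lia.
by split; congr g; apply: funext => l; apply Hx; have := ltn_ord l; lia.
Qed.

Lemma endo_compPl i (c : k) f f' g :
  comp i (c *: f + f') g = c *: comp i f g + comp i f' g.
Proof.
apply: funext => v; rewrite -[RHS]/(c *: (comp i f g) v + (comp i f' g) v).
by rewrite /endo_comp scaler_sumr -big_split.
Qed.

Lemma endo_compPr i (c : k) f g g' : multilinear f ->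
  comp i f (c *: g + g') = c *: comp i f g + comp i f g'.
Proof.
move=> /multilinearE hf; apply: funext => v.
rewrite -[RHS]/(c *: (comp i f g) v + (comp i f g') v).
rewrite /endo_comp scaler_sumr -big_split; apply: eq_bigr => b _ /=.
apply: (hf i); split=> [|j /negbTE ne]; last by rewrite ne.
by rewrite ltnn eqxx endo_gprP.
Qed.

Lemma endo_compDr i f g g' : multilinear f -> comp i f (g + g') = comp i f g + comp i f g'.
Proof. by move=> hf; have := endo_compPr i 1 g g' hf; rewrite !scale1r. Qed.

Lemma endo_compDl i f f' g : comp i (f + f') g = comp i f g + comp i f' g.
Proof. by have := endo_compPl i 1 f f' g; rewrite !scale1r. Qed.

(** The sign of moving g past the entries before position i. *)
Lemma ev_endo_comp b e u i f g : multilinear f -> multilinear g -> hdeg b g -> hfam e u ->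
  ev (comp i f g) u =
    (-1) ^+ (b && psum e i) *: ev f (insert_block i n u (ev g (shift i u))).
Proof.
move=> hf hg hb hu; have lim := ltn_ord i; rewrite {1}/ev /endo_comp (bigD1 b) //=.
rewrite [X in _ + X]big1 ?addr0 => [|b' /negbTE ne]; last first.
  set w : 'I_m -> V := (X in f X).
  rewrite -ev_slot (@ev0 _ _ _ _ f _ i) // slotE /w ltnn eqxx.
  by rewrite (endo_gpr_hdeg _ hg hb) ne.
transitivity (ev f (fun j => if (j < i)%N then tw b (u j)
    else insert_block i n u (ev g (shift i u)) j)).
  congr f; apply: funext => j; have lj := ltn_ord j; rewrite /insert_block.
  case: ifP => ji; first by rewrite slot_restrict //; lia.
  rewrite hb (inj_eq val_inj); case: ifP => [_|/negbT].
    congr g; apply: funext => l; rewrite slot_restrict //; have := ltn_ord l; lia.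
  by rewrite -(inj_eq val_inj) /= => ne; rewrite slot_restrict //; lia.
rewrite (@ev_tw _ _ _ _ _ _ _ e) ?(ltnW lim) //; congr (_ *: _); apply: eq_ev => j _.
by rewrite /insert_block; case: (j < i)%N.
Qed.

Lemma hdeg_endo_comp a b i f g : multilinear f -> multilinear g -> hdeg a f -> hdeg b g ->
  hdeg (a (+) b) (comp i f g).
Proof.
move=> hf hg ha hb; apply: hdegP => [|e u hu]; first exact: ml_endo_comp.
rewrite (ev_endo_comp _ hf hg hb hu); apply: homogZ.
have := hdeg_ev hf ha (hfam_insert i n hu (hdeg_ev hg hb (hfam_shift i hu))).
by rewrite (psum_insert_block _ _ E (ltn_ord i)) addbA.
Qed.

End Comp.

Lemma ml_endo_id : multilinear (@endo_id k V).
Proof. by apply/multilinearE => i c u v w []; rewrite /endo_id ord1. Qed.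

Lemma hdeg_endo_id : hdeg false (@endo_id k V).
Proof.
apply: hdegP; first exact: ml_endo_id.
by move=> e u hu; rewrite /psum big_nat1; apply: hu.
Qed.

Lemma endo_compf1 m (E : (m + 1 = m.+1)%N) (i : 'I_m) (f : multimap m) : multilinear f ->
  endo_comp i f (@endo_id k V) = f.
Proof.
move=> hf; apply: ev_ext => // [|e u hu]; first exact: ml_endo_comp ml_endo_id.
rewrite (ev_endo_comp E i hf ml_endo_id hdeg_endo_id hu) scale1r.
apply: eq_ev => j _; rewrite /insert_block addn1 /=; case: ifP => // _; case: eqP => // ->.
by rewrite /ev /endo_id /shift addn0.
Qed.

Lemma endo_comp1f m (E : (1 + m = m.+1)%N) (i : 'I_1) (f : multimap m) : multilinear f ->
  endo_comp i (@endo_id k V) f = f.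
Proof.
move: f; apply: hdeg_ind => [g h Eg Eh|b g hg hb].
  by rewrite endo_compDr ?Eg ?Eh //; exact: ml_endo_id.
apply: ev_ext => // [|e u hu]; first exact: ml_endo_comp ml_endo_id _.
rewrite (ev_endo_comp E i ml_endo_id hg hb hu) [i]ord1 psum0 andbF scale1r.
by rewrite /ev /endo_id /=; congr g.
Qed.

End PartialComposition.

(** * Associativity and equivariance of partial compositions *)

Section OperadAxioms.
Variables (k : fieldType) (V : dgModType k).
Implicit Types (a b : bool).
Local Notation multimap n := (('I_n -> V) -> V).

(** On the left h passes the first i + j entries; on the right the composite of g
    and h passes the first i, and then h the next j. *)
Lemma endo_comp_seq m n l p q r
    (e1 : (m + n = p.+1)%N) (e2 : (p + l = r.+1)%N)
    (e3 : (n + l = q.+1)%N) (e4 : (m + q = r.+1)%N)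
    (i : 'I_m) (j : 'I_n) (x : 'I_p) (f : multimap m) (g : multimap n) (h : multimap l) :
  multilinear f -> multilinear g -> multilinear h -> x = (i + j)%N :> nat ->
  endo_comp x (endo_comp i f g : multimap p) h = endo_comp i f (endo_comp j g h : multimap q) :> multimap r.
Proof.
move=> hf + + xij; move: g; apply: hdeg_ind => [g1 g2 IH1 IH2 hh|b g hg hb].
  by rewrite endo_compDr // !endo_compDl endo_compDr // IH1 // IH2.
have hfg := ml_endo_comp e1 i hf hg.
move: h; apply: hdeg_ind => [h1 h2 IH1 IH2|c h hh hc].
  by rewrite !endo_compDr ?IH1 ?IH2.
have hgh := ml_endo_comp e3 j hg hh.
apply: ev_ext => [||e u hu]; [exact: (ml_endo_comp e2 _ hfg hh)|exact: (ml_endo_comp e4 _ hf hgh)|].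
have lim := ltn_ord i; have ljn := ltn_ord j.
have hw := hdeg_ev hh hc (hfam_shift x hu).
have hu' := hfam_insert x l hu hw.
rewrite (ev_endo_comp e2 _ hfg hh hc hu) (ev_endo_comp e1 _ hf hg hb hu').
rewrite (ev_endo_comp e4 _ hf hgh (hdeg_endo_comp e3 j hg hh hb hc) hu).
rewrite (ev_endo_comp e3 _ hg hh hc (hfam_shift i hu)).
rewrite -/(plug q i f u _) (linZ (plugP q u hf lim)) !scalerA -!signr_addb.
congr (_ ^+ _ *: _).
  rewrite xij psumD (@eq_psum _ e i) => [|t lt]; last by rewrite /insert_block ifT; lia.
  by bool_cases.
have -> : ev h (shift j (shift i u)) = ev h (shift x u).
  by apply: eq_ev => t _; rewrite /shift xij addnA.
rewrite /plug; set w := ev h _.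
have -> : ev g (insert_block j l (shift i u) w) = ev g (shift i (insert_block x l u w)).
  apply: eq_ev => t _; rewrite /shift /insert_block xij ltn_add2l eqn_add2l.
  case: ltngtP => // tj; congr u; lia.
apply: eq_ev => t _; have [->|ti] := eqVneq t (i : nat); first by rewrite !insert_block_in.
have nx : outer i n t != x by rewrite /outer; case: ifP; lia.
rewrite !insert_block_outer // /outer.
by case: (ltnP t i) => ?; case: ifP => ?; congr u; lia.
Qed.

(** On the right-hand side h passes the inserted value of g, on the left-hand side
    only the arguments of g. *)
Lemma endo_comp_par m n l p q r
    (e1 : (m + n = p.+1)%N) (e2 : (p + l = r.+1)%N)
    (e3 : (m + l = q.+1)%N) (e4 : (q + n = r.+1)%N)
    (i j : 'I_m) (x : 'I_p) (y : 'I_q) b c (f : multimap m) (g : multimap n) (h : multimap l) :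
  multilinear f -> multilinear g -> multilinear h ->
  (i < j)%N -> x.+1 = (j + n)%N :> nat -> y = i :> nat ->
  hdeg b g -> hdeg c h ->
  endo_comp x (endo_comp i f g : multimap p) h =
    (-1) ^+ (b && c) *: (endo_comp y (endo_comp j f h : multimap q) g : multimap r).
Proof.
move=> hf hg hh ij xj yi hb hc.
have hfg := ml_endo_comp e1 i hf hg; have hfh := ml_endo_comp e3 j hf hh.
apply: ev_ext => [||e u hu]; [exact: (ml_endo_comp e2 _ hfg hh)|apply: mlZ; exact: (ml_endo_comp e4 _ hfh hg)|].
have lim := ltn_ord i; have ljm := ltn_ord j.
rewrite -[RHS]/((-1) ^+ (b && c) *: ev (endo_comp y (endo_comp j f h : multimap q) g) u).
have hw := hdeg_ev hh hc (hfam_shift x hu).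
have hu' := hfam_insert x l hu hw.
have hz := hdeg_ev hg hb (hfam_shift y hu).
have hv' := hfam_insert y n hu hz.
rewrite (ev_endo_comp e2 _ hfg hh hc hu) (ev_endo_comp e1 _ hf hg hb hu').
rewrite (ev_endo_comp e4 _ hfh hg hb hu) (ev_endo_comp e3 _ hf hh hc hv').
rewrite !scalerA -!signr_addb; congr (_ ^+ _ *: _).
  have E : (j + n = x.+1)%N by rewrite xj.
  rewrite yi (psum_insert_block _ _ E ij).
  rewrite (@eq_psum _ e i) => [|t lt]; last by rewrite /insert_block ifT; lia.
  by bool_cases.
rewrite yi; set w := ev h (shift x u); set z := ev g (shift i u).
have -> : ev g (shift i (insert_block x l u w)) = z.
  apply: eq_ev => t lt; rewrite /shift /insert_block ifT //; lia.
have -> : ev h (shift j (insert_block i n u z)) = w.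
  apply: eq_ev => t lt; rewrite /shift /insert_block ifF; last lia.
  by rewrite ifF; [congr u|]; lia.
apply: eq_ev => t lt; rewrite /insert_block.
by case: (ltngtP t i) => ?; case: (ltngtP t j) => ?; do ?case: ltngtP => ?;
   try by []; try lia; congr u; lia.
Qed.

Lemma hdeg_perm_act n b (t : 'S_n) (g : multimap n) : multilinear g -> hdeg b g ->
  hdeg b (perm_act t g).
Proof.
move=> hg hb; apply: hdegP => [|e u hu]; first exact: ml_perm_act.
rewrite (ev_perm_act _ hg hu); apply: homogZ; rewrite -(psum_perm t).
by apply: hdeg_ev => // j; apply: hu.
Qed.

Lemma perm_actD (W : lmodType k) n (t : 'S_n) (f g : ('I_n -> V) -> W) :
  perm_act t (f + g) = perm_act t f + perm_act t g.
Proof. by have := perm_actP t 1 f g; rewrite !scale1r. Qed.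

(** By [koszul_parity_block] the signs of r and of the pair (s, t) agree, except
    that the inserted value of g also carries the parity of g.  By
    [koszul_parity_flip] this accounts for the different entries that g passes:
    those before position i on one side, those before s i on the other. *)
Lemma endo_comp_act m n p (E : (m + n = p.+1)%N) (i : 'I_m)
    (s : 'S_m) (t : 'S_n) (r : 'S_p) (f : multimap m) (g : multimap n) :
  multilinear f -> multilinear g ->
  (forall (j : 'I_n) (x : 'I_p), x = (i + j)%N :> nat ->
     r x = (s i + t j)%N :> nat) ->
  (forall (j : 'I_m) (x : 'I_p), j != i ->
     x = (if j < i then j : nat else (j + n).-1)%N :> nat ->
     r x = (if s j < s i then s j : nat else (s j + n).-1)%N :> nat) ->
  endo_comp (s i) (perm_act s f) (perm_act t g) = perm_act r (endo_comp i f g : multimap p).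
Proof.
move=> hf + H1 H2; have hs := ml_perm_act s hf.
move: g; apply: hdeg_ind => [g1 g2 IH1 IH2|b g hg hb].
  by rewrite perm_actD !endo_compDr // perm_actD IH1 IH2.
have lim := ltn_ord i.
have Hin l : (l < n)%N -> nat_perm r (i + l) = (s i + nat_perm t l)%N.
  move=> lt; have lp : (i + l < p)%N by lia.
  by rewrite (nat_permE r (Ordinal lp)) (H1 (Ordinal lt)) // -(nat_permE t).
have Hout j : (j < m)%N -> j != i -> nat_perm r (outer i n j) = outer (s i) n (nat_perm s j).
  move=> lj nj; have lp : (outer i n j < p)%N by rewrite /outer; case: ifP; lia.
  rewrite (nat_permE r (Ordinal lp)) (H2 (Ordinal lj)) // /outer.
  by rewrite (nat_permE s (Ordinal lj)).
have ht := ml_perm_act t hg.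
have hfg := ml_endo_comp E i hf hg.
apply: ev_ext => [||e u hu]; [exact: (ml_endo_comp E _ hs ht)|exact: ml_perm_act|].
have hv : hfam (e \o nat_perm r) (u \o nat_perm r) by move=> j; apply: hu.
have htb := hdeg_perm_act t hg hb.
have hw := hdeg_ev ht htb (hfam_shift (s i) hu).
have hu' := hfam_insert (s i) n hu hw.
rewrite (ev_endo_comp E _ hs ht htb hu) (ev_perm_act _ hf hu').
rewrite (ev_perm_act _ hfg hu) (ev_endo_comp E _ hf hg hb hv).
have Ew : ev (perm_act t g) (shift (s i) u) = (-1) ^+ koszul_parity t (shift (s i) e) *:
    ev g (shift i (u \o nat_perm r)).
  rewrite (ev_perm_act _ hg (hfam_shift _ hu)); congr (_ *: _).
  by apply: eq_ev => l ll; rewrite /shift /= Hin.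
have sinj (j : 'I_m) : (s j == s i :> nat) = (j == i :> nat).
  by rewrite !(inj_eq val_inj) (inj_eq perm_inj).
set w := ev (perm_act t g) _ in hw hu' Ew *.
have -> : ev f (insert_block (s i) n u w \o nat_perm s) =
    (-1) ^+ koszul_parity t (shift (s i) e) *:
    ev f (insert_block i n (u \o nat_perm r) (ev g (shift i (u \o nat_perm r)))).
  rewrite -(linZ (plugP n _ hf lim)) -Ew; apply: eq_ev => j lj /=.
  have := sinj (Ordinal lj); rewrite -nat_permE /=.
  case: (eqVneq j i) => [->|nj] sj; first by rewrite nat_permE !insert_block_in.
  by rewrite !insert_block_outer ?sj //= Hout.
rewrite !scalerA -!signr_addb; congr (_ ^+ _ *: _).
rewrite (koszul_parity_block e E Hin Hout).
set G := psum (shift (s i) e) n; set e0 := insert_block (s i) n e G.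
have -> : koszul_parity s (insert_block (s i) n e (b (+) G)) =
    koszul_parity s (fun x => e0 x (+) (b && (x == s i))).
  congr (koszul_parity s _); apply: funext => x; rewrite /e0 /insert_block.
  by case: ltngtP; rewrite ?andbF ?addbF // andbT addbC.
rewrite koszul_parity_flip.
have -> : psum e0 (s i) = psum e (s i).
  by apply: eq_psum => j lj; rewrite /e0 /insert_block lj.
have -> : psum (e0 \o nat_perm s) i = psum (e \o nat_perm r) i.
  apply: eq_psum => j lj /=; have ljm : (j < m)%N by lia.
  have nj : j != i by rewrite neq_ltn lj.
  rewrite /e0 insert_block_outer ?(sinj (Ordinal ljm)) -?Hout //.
    by rewrite /outer lj.
  by rewrite (nat_permE s (Ordinal ljm)) sinj.
move: (koszul_parity _ _) (koszul_parity _ _) => y z; bool_cases.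
Qed.

End OperadAxioms.

(** * The Leibniz rule *)

Section Derivation.
Variables (k : fieldType) (V : dgModType k).
Implicit Types (a b : bool).
Local Notation multimap n := (('I_n -> V) -> V).

(** The terms of d(f o_i g) in which d hits an input outside the block are those of
    (d f) o_i g; inside the block they are those of f o_i (d g).  What remains
    is d applied to the inserted value of g, which occurs in both summands with
    opposite signs. *)
Lemma endo_comp_diff m n p (E : (m + n = p.+1)%N) (i : 'I_m) a (f : multimap m) (g : multimap n) :
  multilinear f -> multilinear g -> hdeg a f ->
  endo_diff (endo_comp i f g : multimap p) =
    endo_comp i (endo_diff f) g + (-1) ^+ a *: endo_comp i f (endo_diff g).
Proof.
move=> hf + ha; have hdf := ml_endo_diff hf.
move: g; apply: hdeg_ind => [g1 g2 IH1 IH2|b g hg hb].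
  rewrite (endo_compDr _ i g1 g2 hf) endo_diffD IH1 IH2 (endo_diffD g1 g2).
  rewrite (endo_compDr _ i g1 g2 hdf) (endo_compDr _ i (endo_diff g1) (endo_diff g2) hf).
  by rewrite scalerDr addrACA.
have hdg := ml_endo_diff hg.
have hfg := ml_endo_comp E i hf hg.
apply: ev_ext => [||e u hu]; first exact: ml_endo_diff.
  by apply: mlD; [exact: (ml_endo_comp E i hdf hg)|apply: mlZ; exact: (ml_endo_comp E i hf hdg)].
have lim := ltn_ord i.
rewrite (ev_endo_diff hfg (hdeg_endo_comp E i hf hg ha hb) hu).
rewrite -[RHS]/(ev (endo_comp i (endo_diff f) g : multimap p) u +
  (-1) ^+ a *: ev (endo_comp i f (endo_diff g) : multimap p) u).
have hG := hdeg_ev hg hb (hfam_shift i hu).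
have hU := hfam_insert i n hu hG.
rewrite (ev_endo_comp E i hdf hg hb hu) (ev_endo_comp E i hf hg hb hu).
rewrite (ev_endo_comp E i hf hdg (hdeg_endo_diff hg hb) hu).
rewrite (ev_endo_diff hf ha hU) (ev_endo_diff hg hb (hfam_shift i hu)).
rewrite linearZ /= scalerBr -addrA; congr (_ + _).
set G := ev g (shift i u); set U := insert_block i n u G.
set e' := insert_block i n e _ in hU *.
have plug_lin := plugP n u hf lim.
rewrite -/(plug n i f u _) (linB plug_lin) (lin_sum plug_lin) !scalerBr.
pose T x := (-1) ^+ (a (+) b (+) psum e x (+) (b && psum (flip e x) i)) *:
  plug n i f (dupdate u x) (ev g (shift i (dupdate u x))).
have -> : \sum_(0 <= x < p) (-1) ^+ (a (+) b (+) psum e x) *: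
    ev (endo_comp i f g : multimap p) (dupdate u x) = \sum_(0 <= x < p) T x.
  apply: eq_bigr => x _; rewrite (ev_endo_comp E i hf hg hb (hfam_dupdate x hu)).
  by rewrite scalerA -signr_addb.
have psum_e' j : (i < j)%N -> psum e' j = b (+) psum e (j + n).-1.
  by move=> ij; apply: psum_insert_block => //; lia.
pose S j := (-1) ^+ (a (+) psum e' j) *: ev f (dupdate U j).
(* away from the block, the two sums agree term by term *)
have ST j : (j < m)%N -> j != i ->
    T (outer i n j) = (-1) ^+ (b && psum e i) *: S j.
  move=> lj nj; rewrite /T /S scalerA -signr_addb psum_flip.
  have -> : ev g (shift i (dupdate u (outer i n j))) = G.
    apply: eq_ev => l ll; rewrite /shift /dupdate /update ifF //.
    by rewrite /outer; case: ifP => ?; lia.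
  congr (_ ^+ _ *: _).
    have [lt|gt|eq] := ltngtP j i; last by rewrite eq eqxx in nj.
      have -> : psum e' j = psum e j.
        by apply: eq_psum => x lx; rewrite /e' /insert_block ifT //; lia.
      by rewrite /outer !lt; bool_cases.
    rewrite (psum_e' j gt) /outer ltnNge (ltnW gt) /=.
    rewrite (_ : ((j + n).-1 < i)%N = false); last by lia.
    by bool_cases.
  apply: eq_ev => t lt; rewrite /dupdate /update.
  have [->|nt] := eqVneq t (i : nat).
    by rewrite insert_block_in eq_sym (negbTE nj) /U insert_block_in.
  rewrite insert_block_outer // /U !insert_block_outer //.
  rewrite (_ : (outer i n t == outer i n j) = (t == j)) //.
  by rewrite /outer; case: ifP => ?; case: ifP => ?; lia.
rewrite (big_insert_block _ T E lim).
have ip (F : nat -> V) : \sum_(0 <= j < m) F j = F i + \sum_(0 <= j < m | j != i) F j.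
  by rewrite (bigD1_seq (i : nat)) ?iota_uniq ?mem_index_iota.
rewrite -/(S _) !ip insert_block_in scalerDr.
have -> : \sum_(0 <= j < m | j != i) insert_block i n T (\sum_(0 <= l < n) T (i + l)%N) j =
    (-1) ^+ (b && psum e i) *: \sum_(0 <= j < m | j != i) S j.
  rewrite scaler_sumr big_nat_cond [RHS]big_nat_cond; apply: eq_bigr => j /andP[/andP[_ lj] nj].
  by rewrite insert_block_outer // ST.
(* the term where d hits the plugged value is the first one of f o d g *)
have -> : (-1) ^+ (b && psum e i) *: S i =
    (-1) ^+ a *: ((-1) ^+ (~~ b && psum e i) *: plug n i f u (diff V G)).
  rewrite /S !scalerA -!signr_addb; congr (_ ^+ _ *: _).
    have -> : psum e' i = psum e i.
      by apply: eq_psum => x lx; rewrite /e' /insert_block lx.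
    by bool_cases.
  apply: eq_ev => t _; rewrite /dupdate /update; have [->|nt] := eqVneq t (i : nat).
    by rewrite /U !insert_block_in.
  by rewrite /U !insert_block_outer.
have -> : \sum_(0 <= l < n) T (i + l)%N = - ((-1) ^+ a *: ((-1) ^+ (~~ b && psum e i) *:
    - \sum_(0 <= l < n) plug n i f u
        ((-1) ^+ (b (+) psum (shift i e) l) *: ev g (dupdate (shift i u) l)))).
  rewrite !scalerN opprK !scaler_sumr; apply: eq_big_nat => l /andP[_ ll].
  rewrite (linZ plug_lin) !scalerA -!signr_addb /T psum_flip psumD; congr (_ ^+ _ *: _).
    rewrite (_ : (i + l < i)%N = false); last by lia.
    by bool_cases.
  have -> : ev g (shift i (dupdate u (i + l))) = ev g (dupdate (shift i u) l).
    by apply: eq_ev => t _; rewrite /shift /dupdate /update eqn_add2l.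
  apply: eq_ev => t lt; have [->|nt] := eqVneq t (i : nat).
    by rewrite !insert_block_in.
  rewrite !insert_block_outer // /dupdate /update ifF //.
  by rewrite /outer; case: ifP => ?; lia.
have cancel (x y z : V) : - x - y = - z - y + (z - x).
  by rewrite [- z - y]addrC addrA subrK addrC.
rewrite !scalerN ?opprK ?opprD; exact: cancel.
Qed.

End Derivation.

(** * The map from multilinear maps to multilinear forms *)

Section Pairing.
Variables (k : fieldType) (V : dgModType k) (form : innerProduct V).
Implicit Types (a b : bool).
Local Notation multimap n := (('I_n -> V) -> V).
Local Notation alpha := (alpha form).

Lemma formZl (c : k) v w : form (c *: v) w = c * form v w.
Proof.
have f0 : form 0 w = 0.
  by have := ip_linearl form w (-1) 0 0; rewrite /= scaler0 addr0 mulN1r addNr.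
by have := ip_linearl form w c v 0; rewrite /= addr0 f0 addr0.
Qed.

Lemma formZr (c : k) v w : form v (c *: w) = c * form v w.
Proof.
have f0 : form v 0 = 0.
  by have := ip_linearr form v (-1) 0 0; rewrite /= scaler0 addr0 mulN1r addNr.
by have := ip_linearr form v c w 0; rewrite /= addr0 f0 addr0.
Qed.

Lemma form0l w : form 0 w = 0.
Proof. by have := formZl 0 0 w; rewrite scale0r mul0r. Qed.

Lemma formDl v v' w : form (v + v') w = form v w + form v' w.
Proof. by have := ip_linearl form w 1 v v'; rewrite /= scale1r mul1r. Qed.

Lemma formDr v w w' : form v (w + w') = form v w + form v w'.
Proof. by have := ip_linearr form v 1 w w'; rewrite /= scale1r mul1r. Qed.

Lemma formNl v w : form (- v) w = - form v w.
Proof. by rewrite -scaleN1r formZl mulN1r. Qed.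

Lemma form_suml I r (P : pred I) F w :
  form (\sum_(i <- r | P i) F i) w = \sum_(i <- r | P i) form (F i) w.
Proof. exact: (big_morph (fun v => form v w) (fun v v' => formDl v v' w) (form0l w)). Qed.

Lemma ev_alpha n (f : multimap n) u : ev (alpha f) u = form (ev f u) (u n).
Proof.
rewrite /ev /alpha; congr (form (f _) _); apply: funext => j /=.
by rewrite /bump leqNgt ltn_ord.
Qed.

Lemma ml_alpha n (f : multimap n) : multilinear f -> multilinear (alpha f).
Proof.
move=> /multilinearE hf; apply/multilinearE => i c u v w [E H]; rewrite /Defs.alpha.
have [j0|] := unliftP ord_max i => Ei.
  have lin : lin_at j0 c (fun j => u (lift ord_max j)) (fun j => v (lift ord_max j))
      (fun j => w (lift ord_max j)).
    by split=> [|j' ne]; [rewrite -Ei|apply: H; rewrite Ei (inj_eq lift_inj)].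
  have [-> ->] : v ord_max = u ord_max /\ w ord_max = u ord_max.
    by apply: H; rewrite Ei neq_lift.
  by rewrite (hf _ _ _ _ _ lin) formDl formZl.
have EH (x : 'I_n.+1 -> V) : (forall j, j != i -> x j = u j) ->
    (fun j => x (lift ord_max j)) = (fun j => u (lift ord_max j)).
  by move=> Ex; apply: funext => j; apply: Ex; rewrite Ei eq_sym neq_lift.
rewrite (EH v) => [|j /H[]//]; rewrite (EH w) => [|j /H[]//].
by rewrite -Ei E formDr formZr.
Qed.

Lemma alpha_inj n (f g : multimap n) : weakly_nondegenerate form -> alpha f = alpha g -> f = g.
Proof.
move=> nondeg E; apply: funext => v; apply: nondeg; apply: funext => w.
pose u := update (slot v) n w.
have := congr1 (fun phi => ev phi u) E; rewrite !ev_alpha.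
have Ef (h : multimap n) : ev h u = h v.
  rewrite -[RHS]ev_slot; apply: eq_ev => j lt; rewrite /u /update ifF //; lia.
by rewrite !Ef /u /update eqxx.
Qed.

Lemma alphaZ n (c : k) (f : multimap n) : alpha (c *: f) = c *: alpha f.
Proof. by have := alphaP form c f 0; rewrite alpha0 !addr0. Qed.

Lemma perm_actZ (W : lmodType k) n (s : 'S_n) (c : k) (f : ('I_n -> V) -> W) :
  perm_act s (c *: f) = c *: perm_act s f.
Proof.
have E0 : perm_act s (0 : ('I_n -> V) -> W) = 0.
  have := perm_actP s (-1) (0 : ('I_n -> V) -> W) 0.
  by rewrite scaler0 addr0 scaleN1r addNr.
by have := perm_actP s c f 0; rewrite E0 !addr0.
Qed.

Lemma alpha_perm_lift n (s : 'S_n) (f : multimap n) : multilinear f ->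
  alpha (perm_act s f) = perm_act (lift_perm ord_max ord_max s) (alpha f).
Proof.
move=> hf; have ha := ml_alpha hf; apply: ev_ext.
- by apply: ml_alpha; exact: ml_perm_act.
- exact: ml_perm_act.
move=> e u hu; rewrite ev_alpha (ev_perm_act _ hf hu) (ev_perm_act _ ha hu).
rewrite koszul_parity_lift formZl ev_alpha /=; congr (_ * form _ _).
  by apply: eq_ev => j _ /=; rewrite nat_perm_lift.
by rewrite nat_perm_lift /nat_perm insubF ?ltnn.
Qed.

(** The pairing with w only sees the component of the complementary parity. *)
Lemma form_gprl a b v w : homog b w ->
  form (gpr V a v) w = if a (+) b == ip_parity form then form v w else 0.
Proof.
move=> hw.
have E0 a' : a' (+) b != ip_parity form -> form (gpr V a' v) w = 0.
  by move=> ne; apply: ip_homog hw ne; apply: homog_gpr.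
case: eqP => [Ea|/eqP]; last exact: E0.
rewrite -[in RHS](gpr_sum v) formDl.
case: a Ea => Ea.
  by rewrite (E0 false) ?add0r //; apply/eqP => E; move: Ea; rewrite -E; case: (b).
by rewrite (E0 true) ?addr0 //; apply/eqP => E; move: Ea; rewrite -E; case: (b).
Qed.

Lemma ev_alpha_gpr n b (f : multimap n) e u : multilinear f -> hfam e u ->
  ev (alpha (endo_gpr b f)) u =
    if b (+) psum e n.+1 == ip_parity form then ev (alpha f) u else 0.
Proof.
move=> hf hu; rewrite !ev_alpha (ev_endo_gpr _ hf hu) (form_gprl _ _ (hu n)).
by rewrite psumS addbA.
Qed.

(** On forms, the projection onto a degree selects families by their total
    parity, which a permutation does not change. *)
Lemma alpha_gpr_perm n b (s : 'S_n.+1) (f h : multimap n) : multilinear f -> multilinear h ->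
  perm_act s (alpha f) = alpha h ->
  perm_act s (alpha (endo_gpr b f)) = alpha (endo_gpr b h).
Proof.
move=> hf hh E; have hfb := ml_alpha (ml_endo_gpr b hf).
apply: ev_ext; [exact: ml_perm_act|by apply: ml_alpha; exact: ml_endo_gpr|] => e u hu.
have hv : hfam (e \o nat_perm s) (u \o nat_perm s) by move=> j; apply: hu.
rewrite (ev_perm_act _ hfb hu) (ev_alpha_gpr _ hf hv) (ev_alpha_gpr _ hh hu) psum_perm.
case: ifP => _; last by rewrite scaler0.
by rewrite -E (ev_perm_act _ (ml_alpha hf) hu).
Qed.

(** Compatibility of the form with d turns d of the output into d of the last
    variable, with the sign of the total derivation. *)
Lemma ev_alpha_diff n a (f : multimap n) e u : multilinear f -> hdeg a f -> hfam e u ->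
  ev (alpha (endo_diff f)) u =
    - \sum_(0 <= i < n.+1) (-1) ^+ (a (+) psum e i) *: ev (alpha f) (dupdate u i).
Proof.
move=> hf ha hu; rewrite ev_alpha (ev_endo_diff hf ha hu) formDl formNl form_suml.
rewrite big_nat_recr //= opprD addrC; congr (_ + _).
  congr (- _); apply: eq_big_nat => i /andP[_ lt]; rewrite formZl ev_alpha.
  by rewrite /dupdate /update gtn_eqF.
have := ip_diff form (u n) (hdeg_ev hf ha hu) => E.
rewrite ev_alpha /dupdate /update eqxx.
rewrite (@eq_ev _ _ _ _ f _ u) => [|j lt]; last by rewrite ltn_eqF.
by apply/eqP; rewrite -addr_eq0; apply/eqP.
Qed.

(** The total derivation commutes with permutations: hitting the entry i of the
    permuted family means hitting the entry s i of the original one, and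
    [koszul_parity_flip] compares the signs. *)
Lemma alpha_diff_perm n a (s : 'S_n.+1) (f h : multimap n) :
  multilinear f -> multilinear h -> hdeg a f -> hdeg a h ->
  perm_act s (alpha f) = alpha h ->
  perm_act s (alpha (endo_diff f)) = alpha (endo_diff h).
Proof.
move=> hf hh ha hb E; have hdf := ml_alpha (ml_endo_diff hf).
apply: ev_ext; [exact: ml_perm_act|by apply: ml_alpha; exact: ml_endo_diff|] => e u hu.
have hv : hfam (e \o nat_perm s) (u \o nat_perm s) by move=> j; apply: hu.
rewrite (ev_perm_act _ hdf hu) (ev_alpha_diff hf ha hv) (ev_alpha_diff hh hb hu) -E.
rewrite scalerN scaler_sumr; congr (- _).
rewrite !big_mkord [RHS](reindex_inj (@perm_inj _ s)) /=; apply: eq_bigr => i _.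
rewrite (ev_perm_act _ (ml_alpha hf) (hfam_dupdate (s i) hu)) koszul_parity_flip.
rewrite !scalerA -!signr_addb; congr (_ ^+ _ *: _).
  by move: (koszul_parity _ _) (psum e (s i)) => x y; bool_cases.
apply: eq_ev => j lt; rewrite /dupdate /update /= nat_permE.
by rewrite (nat_permE s (Ordinal lt)) !(inj_eq val_inj) (inj_eq perm_inj) -(inj_eq val_inj).
Qed.

Lemma ev_cycle n (f : multimap n) e u : multilinear f -> hfam e u ->
  ev (perm_act (cycle_perm n) (alpha f)) u =
    (-1) ^+ (e 0%N && psum (shift 1 e) n) * form (ev f (shift 1 u)) (u 0%N).
Proof.
move=> hf hu; rewrite (ev_perm_act _ (ml_alpha hf) hu) koszul_parity_cycle ev_alpha /=.
rewrite nat_perm_cycle_last; congr (_ * form _ _).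
by apply: eq_ev => j lt /=; rewrite nat_perm_cycle.
Qed.

End Pairing.

(** * The cycle acting on partial compositions *)

Section Rotation.
Variables (k : fieldType) (V : dgModType k) (form : innerProduct V).
Implicit Types (a b : bool).
Local Notation multimap n := (('I_n -> V) -> V).
Local Notation alpha := (alpha form).

(* f' is f* in the notation of the introduction. *)
Local Notation rotate n f f' := (perm_act (cycle_perm n) (alpha f) = alpha f').

(** Both sides pair the same value of f with the variable u 0: rotating f* on the
    family with the value of g inserted at i + 1 brings this value to the input
    i of f. *)
Lemma endo_comp_rotate m n p (E : (m + n = p.+1)%N) (i i' : 'I_m) (f f' : multimap m) (g : multimap n) :
  multilinear f -> multilinear f' -> multilinear g -> rotate m f f' ->
  i' = i.+1 :> nat ->
  rotate p (endo_comp i f g : multimap p) (endo_comp i' f' g : multimap p).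
Proof.
move=> hf hf' + ff' ii'; move: g; apply: hdeg_ind => [g1 g2 IH1 IH2|b g hg hb].
  have alphaD q (h1 h2 : multimap q) : alpha (h1 + h2) = alpha h1 + alpha h2.
    by have := alphaP form 1 h1 h2; rewrite !scale1r.
  by rewrite !endo_compDr // !alphaD perm_actD IH1 IH2.
have hfg := ml_endo_comp E i hf hg; have hfg' := ml_endo_comp E i' hf' hg.
apply: ev_ext => [||e u hu]; [by apply: ml_perm_act; exact: ml_alpha|exact: ml_alpha|].
have lim' := ltn_ord i'.
rewrite (ev_cycle form hfg hu) (ev_endo_comp E _ hf hg hb (hfam_shift 1 hu)).
rewrite ev_alpha (ev_endo_comp E _ hf' hg hb hu) !formZl mulrA -signr_addb.
have -> : ev g (shift i (shift 1 u)) = ev g (shift i' u).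
  by apply: eq_ev => l _; rewrite /shift ii' addnA.
set w := ev g _; set U := insert_block i' n u w.
have hw := hdeg_ev hg hb (hfam_shift i' hu).
have hU := hfam_insert i' n hu hw.
set e' := insert_block i' n e _ in hU.
have -> : form (ev f' U) (u p) = ev (alpha f') U.
  rewrite ev_alpha; congr (form _ _); rewrite /U /insert_block ifF ?ifF; [congr u| |]; lia.
rewrite -ff' (ev_cycle form hf hU) mulrA -signr_addb. rewrite -/w -/U.
have -> : U 0%N = u 0%N by rewrite /U /insert_block ii'.
have -> : ev f (shift 1 U) = ev f (insert_block i n (shift 1 u) w).
  apply: eq_ev => j _; rewrite /shift /U /insert_block ii' !add1n ltnS eqSS.
  by case: ltngtP => // ij; congr u; lia.
congr (_ ^+ _ * _).
have e0 : e' 0%N = e 0%N by rewrite /e' /insert_block ii'.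
have E1 : (m.+1 + n = p.+2)%N by rewrite addSn E.
have := psum_insert_block e b E1 (ltnW lim' : (i' < m.+1)%N).
rewrite -/e' [psum e' _]psumSl [psum e p.+1]psumSl ii' [psum e i.+1]psumSl e0.
move: (e 0%N) => y; move: (psum (shift 1 e') m) => z H.
have -> : z = b (+) psum (shift 1 e) p.
  by rewrite -[z](addKb y) H; bool_cases.
by bool_cases.
Qed.

Section Last.
Variables (m n p : nat) (E : (m + n = p.+1)%N) (i : 'I_m) (b : bool).
Variables (f f' : multimap m) (g : multimap n).
Hypotheses (hf : multilinear f) (hf' : multilinear f') (hg : multilinear g).
Hypotheses (ff' : rotate m f f') (hb : hdeg b g) (im : i.+1 = m).

(** Rotating alpha(f) on a family whose last member is the value of g brings this
    value to the last input of f.  The rotated composite is thus the pairing of f* with g, an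
    expression that can be read as a form in either map. *)
Lemma ev_rotate_last e u : hfam e u ->
  ev (perm_act (cycle_perm p) (alpha (endo_comp i f g : multimap p))) u =
    (-1) ^+ (b && psum e m) * form (ev f' u) (ev g (shift m u)).
Proof using E hf hf' hg ff' hb im.
move=> hu; have hfg := ml_endo_comp E i hf hg.
rewrite (ev_cycle form hfg hu) (ev_endo_comp E _ hf hg hb (hfam_shift 1 hu)) formZl mulrA -signr_addb.
have -> : ev g (shift i (shift 1 u)) = ev g (shift m u).
  by apply: eq_ev => l _; rewrite /shift; congr u; lia.
set w := ev g _.
have hw := hdeg_ev hg hb (hfam_shift m hu).
set c := _ (+) _ in hw.
pose U := update u m w; pose eU j := if j == m then c else e j.
have hU : hfam eU U.
  by move=> j; rewrite /eU /U /update; case: eqP.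
have m0 : (0 == m)%N = false by lia.
have -> : form (ev f (insert_block i n (shift 1 u) w)) (u 0%N) =
    (-1) ^+ (e 0%N && (psum (shift 1 e) i (+) c)) * form (ev f' u) w.
  have := congr1 (fun phi => ev phi U) ff'.
  have U0 : U 0%N = u 0%N by rewrite /U /update m0.
  have Um : U m = w by rewrite /U /update eqxx.
  have eU0 : eU 0%N = e 0%N by rewrite /eU m0.
  have -> : ev f' u = ev f' U by apply: eq_ev => j lj; rewrite /U /update ltn_eqF.
  rewrite /= (ev_cycle form hf hU) ev_alpha U0 eU0 Um => <-; rewrite mulrA -signr_addb.
  have -> : psum (shift 1 eU) m = psum (shift 1 e) i (+) c.
    rewrite -[X in psum _ X]im psumS /shift /eU add1n im eqxx; congr (_ (+) _).
    by apply: eq_psum => j lj; rewrite ifF //; lia.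
  rewrite addbb mul1r; congr (form _ _); apply: eq_ev => j lj.
  rewrite /shift /U /update /insert_block !add1n.
  rewrite (_ : (j.+1 == m) = (j == i)); last by rewrite -[X in _ == X]im.
  by case: ltngtP => //; lia.
rewrite mulrA -signr_addb; congr (_ ^+ _ * _).
have -> : psum (shift 1 e) p = psum (shift 1 e) i (+) psum (shift m e) n.
  have -> : p = (i + n)%N by lia.
  rewrite psumD; congr (_ (+) _); apply: eq_psum => l _.
  by rewrite /shift; congr e; lia.
have -> : psum e m = e 0%N (+) psum (shift 1 e) i by rewrite -psumSl im.
subst c; move: (e 0%N) => y; bool_cases.
Qed.

(** The pairing of f* with g, where g is a vector, is the rotation of f* with g in
    first place. *)
Lemma endo_comp_rotate_last0 (f'' : multimap m) (i0 : 'I_m) : multilinear f'' ->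
  rotate m f' f'' -> n = 0%N -> i0 = 0%N :> nat ->
  rotate p (endo_comp i f g : multimap p) (endo_comp i0 f'' g : multimap p).
Proof using E hf hf' hg ff' hb im.
move=> hf'' f'f'' n0 i00; have hfg := ml_endo_comp E i hf hg.
have hfg' := ml_endo_comp E i0 hf'' hg.
apply: ev_ext => [||e u hu]; [by apply: ml_perm_act; exact: ml_alpha|exact: ml_alpha|].
rewrite (ev_rotate_last hu) ev_alpha (ev_endo_comp E _ hf'' hg hb hu) i00 psum0 andbF scale1r.
have -> : ev g (shift 0 u) = ev g (shift m u) by apply: eq_ev => l; rewrite n0.
set w := ev g _; set X := insert_block 0 n u w.
have hX : hfam (insert_block 0 n e b) X.
  apply: hfam_insert => //; have := hdeg_ev hg hb (hfam_shift m hu).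
  by rewrite [X in psum _ X]n0 psum0 addbF.
have -> : form (ev f'' X) (u p) = ev (alpha f'') X.
  by rewrite ev_alpha; congr (form _ _); rewrite /X /insert_block ifF; [congr u|]; lia.
rewrite -f'f'' (ev_cycle form hf' hX) /X insert_block_in.
have -> : psum (shift 1 (insert_block 0 n e b)) m = psum e m.
  by apply: eq_psum => j _; rewrite /shift add1n /insert_block /= n0 addn0.
rewrite insert_block_in; congr (_ * form _ _).
by apply: eq_ev => j _; rewrite /shift add1n /insert_block /= n0 addn0.
Qed.

(** Exchanging the two sides of the pairing of f* with g gives the pairing of g
    with f*, which is the rotation of g with the value of f* in first place. *)
Lemma endo_comp_rotate_last a (g' : multimap n) (E' : (n + m = p.+1)%N) (j : 'I_n) :
  multilinear g' -> rotate n g g' -> hdeg a f' -> j = 0%N :> nat ->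
  rotate p (endo_comp i f g : multimap p) ((-1) ^+ (a && b) *: (endo_comp j g' f' : multimap p)).
Proof using E hf hf' hg ff' hb im.
move=> hg' gg' ha j0; have hfg := ml_endo_comp E i hf hg.
have hgf' := ml_endo_comp E' j hg' hf'.
apply: ev_ext => [||e u hu]; first by apply: ml_perm_act; exact: ml_alpha.
  by apply: ml_alpha; exact: mlZ.
rewrite (ev_rotate_last hu) alphaZ.
rewrite -[RHS]/((-1) ^+ (a && b) * ev (alpha (endo_comp j g' f' : multimap p)) u).
rewrite ev_alpha (ev_endo_comp E' _ hg' hf' ha hu) j0 psum0 andbF scale1r.
have -> : ev f' (shift 0 u) = ev f' u by apply: eq_ev.
have hx := hdeg_ev hf' ha hu; have hw := hdeg_ev hg hb (hfam_shift m hu).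
set x := ev f' u in hx *; set w := ev g _ in hw *; set X := insert_block 0 m u x.
have hX := hfam_insert 0 m hu hx.
have -> : form (ev g' X) (u p) = ev (alpha g') X.
  rewrite ev_alpha; congr (form _ _); have lj := ltn_ord j.
  by rewrite /X /insert_block ifF; [congr u|]; lia.
rewrite -gg' (ev_cycle form hg hX) /X !insert_block_in.
have -> : psum (shift 1 (insert_block 0 m e (a (+) psum e m))) n = psum (shift m e) n.
  by apply: eq_psum => l _; rewrite /shift add1n /insert_block /= addnC.
have -> : ev g (shift 1 (insert_block 0 m u x)) = w.
  by apply: eq_ev => l _; rewrite /shift add1n /insert_block /= addnC.
rewrite (ip_sym form hx hw) !mulrA -!signr_addb; congr (_ ^+ _ * _).
by bool_cases.
Qed.

End Last.

End Rotation.

(** * Closure of the cyclic maps under the operations *)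

Section CyclicMaps.
Variables (k : fieldType) (V : dgModType k) (form : innerProduct V).
Implicit Types (a b : bool).
Local Notation multimap n := (('I_n -> V) -> V).
Local Notation alpha := (alpha form).

Local Notation rotate n f f' := (perm_act (cycle_perm n) (alpha f) = alpha f').
Local Notation in_Ec := (in_Ec form).

Lemma cycle_permX n (i : 'I_n.+1) d : (i + d <= n)%N ->
  (cycle_perm n ^+ d)%g i = (i + d)%N :> nat.
Proof.
elim: d => [|d IH] le; first by rewrite expg0 perm1 addn0.
rewrite expgSr permM cycle_permE IH; last by lia.
by rewrite ifT; lia.
Qed.

Lemma fix_last_lift n (s : 'S_n.+1) : s ord_max = ord_max ->
  exists t : 'S_n, s = lift_perm ord_max ord_max t.
Proof.
move=> smax; pose f (j : 'I_n) := odflt j (unlift ord_max (s (lift ord_max j))).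
have Ef j : lift ord_max (f j) = s (lift ord_max j).
  rewrite /f; case: unliftP => [j' -> //|E].
  by move: E; rewrite -{2}smax => /perm_inj /eqP; rewrite eq_sym (negbTE (neq_lift _ _)).
have inj_f : injective f.
  by move=> j j' E; apply/(@lift_inj _ ord_max)/(@perm_inj _ s); rewrite -!Ef E.
exists (perm inj_f); apply/permP => i; have [j|] := unliftP ord_max i => ->.
  by rewrite lift_perm_lift permE Ef.
by rewrite smax lift_perm_id.
Qed.

(** Some power of the cycle moves to the last place the point that s sends there;
    the remaining factor of s fixes the last point. *)
Lemma cycle_lift_decomp n (s : 'S_n.+1) :
  exists d (t : 'S_n), s = (cycle_perm n ^+ d * lift_perm ord_max ord_max t)%g.
Proof.
pose i := (s^-1)%g ord_max; pose c := (cycle_perm n ^+ (n - i))%g.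
have ci : c i = ord_max.
  by apply: val_inj; have := ltn_ord i => lt; rewrite /c /= cycle_permX ?subnKC.
have /fix_last_lift [t Et] : (c^-1 * s)%g ord_max = ord_max.
  by rewrite permM -{1}ci permK /i permKV.
by exists (n - i)%N, t; rewrite -Et mulKVg.
Qed.

(** Permutations fixing the last point preserve the image of alpha, so only the
    powers of the cycle need to be examined. *)
Lemma in_Ec_rotations n (f : multimap n) : multilinear f ->
  (forall d, exists2 h : multimap n, multilinear h &
     perm_act (cycle_perm n ^+ d)%g (alpha f) = alpha h) -> in_Ec f.
Proof.
move=> hf H; split=> // s; have [d [t ->]] := cycle_lift_decomp s.
have [h hh E] := H d; exists (perm_act t h); first exact: ml_perm_act.
by rewrite (perm_actM _ _ (ml_alpha _ hf)) E alpha_perm_lift.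
Qed.

Lemma rotate_id : rotate 1 (@endo_id k V) (@endo_id k V).
Proof.
have hid : multilinear (@endo_id k V) by exact: ml_endo_id.
have haid := ml_alpha form hid; apply: ev_ext => // [|e u hu]; first exact: ml_perm_act.
rewrite (ev_cycle form hid hu) ev_alpha psumS psum0 /=.
by rewrite -(ip_sym form (hu 0%N) (hu 1%N)).
Qed.

Lemma in_Ec_id : in_Ec (@endo_id k V).
Proof.
have hid : multilinear (@endo_id k V) by exact: ml_endo_id.
apply: in_Ec_rotations => // d; exists (@endo_id k V) => //.
have haid := ml_alpha form hid.
elim: d => [|d IH]; first by rewrite expg0 perm_act1.
by rewrite expgSr perm_actM // IH rotate_id.
Qed.

Lemma in_EcP n (c : k) (f g : multimap n) : in_Ec f -> in_Ec g -> in_Ec (c *: f + g).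
Proof.
move=> /asboolP hf /asboolP hg; apply/asboolP.
by have [_ H] := Ec_submod_closed form n; apply: H.
Qed.

Lemma in_EcD n (f g : multimap n) : in_Ec f -> in_Ec g -> in_Ec (f + g).
Proof. by move=> hf hg; rewrite -[f]scale1r; apply: in_EcP. Qed.

Lemma in_Ec_perm n (s : 'S_n.+1) (f h : multimap n) : in_Ec f -> multilinear h ->
  perm_act s (alpha f) = alpha h -> in_Ec h.
Proof.
move=> [hf Hf] hh E; split=> // t; have [h' hh' E'] := Hf (s * t)%g.
by exists h' => //; rewrite -E -perm_actM //; exact: ml_alpha.
Qed.

Lemma in_Ec_gpr n b (f : multimap n) : in_Ec f -> in_Ec (endo_gpr b f).
Proof.
move=> [hf Hf]; split=> [|s]; first exact: ml_endo_gpr.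
have [h hh E] := Hf s; exists (endo_gpr b h); first exact: ml_endo_gpr.
exact: alpha_gpr_perm.
Qed.

Hypothesis nondeg : weakly_nondegenerate form.

Lemma hdeg_perm n a (s : 'S_n.+1) (f h : multimap n) : multilinear f -> multilinear h ->
  perm_act s (alpha f) = alpha h -> hdeg a f -> hdeg a h.
Proof.
move=> hf hh E ha; apply: (alpha_inj nondeg).
by rewrite -(alpha_gpr_perm a hf hh E) ha.
Qed.

Lemma in_Ec_diff n (f : multimap n) : in_Ec f -> in_Ec (endo_diff f).
Proof.
move=> hEf; have [hf _] := hEf; rewrite -(endo_gpr_sum hf) endo_diffD.
suff H b : in_Ec (endo_diff (endo_gpr b f)) by apply: in_EcD.
have [hfb Hfb] := in_Ec_gpr b hEf; have hb := hdeg_gpr b hf.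
split=> [|s]; first exact: ml_endo_diff.
have [h hh E] := Hfb s; exists (endo_diff h); first exact: ml_endo_diff.
exact: alpha_diff_perm hb (hdeg_perm hfb hh E hb) E.
Qed.

(** A class of maps that the cycle preserves; the scalar absorbs the signs. *)
Inductive composite p : multimap p -> Prop :=
  Composite m n (E : (m + n = p.+1)%N) (i : 'I_m) (f : multimap m) (g : multimap n) a b (c : k) of
    in_Ec f & in_Ec g & hdeg a f & hdeg b g : composite (c *: endo_comp i f g).

Lemma ml_composite p (F : multimap p) : composite F -> multilinear F.
Proof. by case=> m n E i f g a b c [hf _] [hg _] _ _; apply: mlZ; exact: ml_endo_comp. Qed.

Lemma composite_rotate p (F : multimap p) : composite F ->
  exists2 F' : multimap p, composite F' & rotate p F F'.
Proof.
case=> m n E i f g a b c hEf hEg ha hb; have [hf Hf] := hEf; have [hg Hg] := hEg.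
have [f' hf' ff'] := Hf (cycle_perm m).
have hEf' := in_Ec_perm hEf hf' ff'; have ha' := hdeg_perm hf hf' ff' ha.
have lim := ltn_ord i.
rewrite alphaZ perm_actZ; have [lt|ge] := ltnP i.+1 m.
  exists (c *: endo_comp (Ordinal lt) f' g); first exact: Composite ha' hb.
  by rewrite alphaZ (@endo_comp_rotate _ _ _ _ _ _ E i (Ordinal lt) _ f').
have im : i.+1 = m by lia.
have [n0|n_gt0] := posnP n.
  have [_ Hf'] := hEf'; have [f'' hf'' f'f''] := Hf' (cycle_perm m).
  have m_gt0 : (0 < m)%N by lia.
  exists (c *: endo_comp (Ordinal m_gt0) f'' g).
    apply: (Composite E _ _ _ hEg (hdeg_perm hf' hf'' f'f'' ha') hb).
    exact: in_Ec_perm hEf' hf'' f'f''.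
  rewrite alphaZ.
  by rewrite (@endo_comp_rotate_last0 _ _ _ _ _ _ E i b f f' g hf hf' hg ff' hb im f'' (Ordinal m_gt0)).
have [g' hg' gg'] := Hg (cycle_perm n).
have hEg' := in_Ec_perm hEg hg' gg'; have hb' := hdeg_perm hg hg' gg' hb.
have E' : (n + m = p.+1)%N by rewrite addnC.
exists ((c * (-1) ^+ (a && b)) *: endo_comp (Ordinal n_gt0) g' f').
  exact: (Composite E' (Ordinal n_gt0) (c * (-1) ^+ (a && b)) hEg' hEf' hb' ha').
rewrite -scalerA alphaZ.
congr (_ *: _).
exact: (endo_comp_rotate_last E hf hf' hg ff' hb im E' hg' gg' ha').
Qed.

Lemma in_Ec_composite p (F : multimap p) : composite F -> in_Ec F.
Proof.
move=> hF; have mF := ml_composite hF; apply: in_Ec_rotations => // d.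
suff [F' cF' E] : exists2 F', composite F' & perm_act (cycle_perm p ^+ d)%g (alpha F) = alpha F'.
  by exists F' => //; exact: ml_composite.
elim: d => [|d [F' /composite_rotate [F'' cF'' E''] E']].
  by exists F => //; rewrite expg0 perm_act1 //; exact: ml_alpha.
by exists F'' => //; rewrite expgSr perm_actM ?E' //; exact: ml_alpha.
Qed.

(** Composition is bilinear and E_c is closed under taking homogeneous parts, so
    this reduces to composites of homogeneous maps. *)
Lemma in_Ec_comp m n p (E : (m + n = p.+1)%N) (i : 'I_m) (f : multimap m) (g : multimap n) :
  in_Ec f -> in_Ec g -> in_Ec (endo_comp i f g : multimap p).
Proof.
move=> hf hg; have [mf _] := hf; have [mg _] := hg.
suff H a b : in_Ec (endo_comp i (endo_gpr a f) (endo_gpr b g) : multimap p).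
  rewrite -(endo_gpr_sum mf) -(endo_gpr_sum mg) endo_compDl !endo_compDr; try exact: ml_endo_gpr.
  by apply: in_EcD; apply: in_EcD.
rewrite -[endo_comp _ _ _]scale1r; apply: in_Ec_composite.
by apply: (Composite E i 1 (in_Ec_gpr a hf) (in_Ec_gpr b hg)); apply: hdeg_gpr.
Qed.

End CyclicMaps.

(** * The cyclic operad *)

Section CyclicOperadStructure.
Variables (k : fieldType) (V : dgModType k) (form : innerProduct V).
Implicit Types (a b : bool).
Local Notation multimap n := (('I_n -> V) -> V).
Local Notation alpha := (alpha form).

Local Notation in_Ec := (in_Ec form).
Hypothesis nondeg : weakly_nondegenerate form.

Lemma Ec_in n (f : Ec form n) : in_Ec f.
Proof. by case: f => h hf; apply/asboolP. Qed.

Lemma Ec_ml n (f : Ec form n) : multilinear f.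
Proof. by have [] := Ec_in f. Qed.

Definition mkEc n (f : multimap n) (hf : in_Ec f) : Ec form n := MkEc (asboolT hf : f \in Ec_pred form (n := n)).

Lemma Ec_val_inj n : injective (@Ec_val k V form n).
Proof. exact: val_inj. Qed.

Lemma Ec_alpha_inj n (f g : Ec form n) : alpha f = alpha g -> f = g.
Proof. by move=> E; apply: Ec_val_inj; apply: alpha_inj E. Qed.

Section Grading.
Variable n : nat.

Definition Ec_gpr b (f : Ec form n) : Ec form n := mkEc (in_Ec_gpr b (Ec_in f)).
Definition Ec_diff (f : Ec form n) : Ec form n := mkEc (in_Ec_diff nondeg (Ec_in f)).

Lemma Ec_gpr_linear b : linear (Ec_gpr b).
Proof. by move=> c f g; apply: Ec_val_inj; apply: endo_gprP. Qed.

Lemma Ec_diff_linear : linear Ec_diff.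
Proof. by move=> c f g; apply: Ec_val_inj; apply: endo_diffP. Qed.

HB.instance Definition _ b :=
  GRing.isLinear.Build k (Ec form n) (Ec form n) _ (Ec_gpr b) (Ec_gpr_linear b).
HB.instance Definition _ :=
  GRing.isLinear.Build k (Ec form n) (Ec form n) _ Ec_diff Ec_diff_linear.

Lemma Ec_gpr_gpr a b f : Ec_gpr a (Ec_gpr b f) = if a == b then Ec_gpr b f else 0.
Proof.
apply: Ec_val_inj; rewrite /= endo_gpr_gpr; last exact: Ec_ml.
by case: ifP.
Qed.

Lemma Ec_gpr_sum f : Ec_gpr false f + Ec_gpr true f = f.
Proof. by apply: Ec_val_inj; apply: endo_gpr_sum; exact: Ec_ml. Qed.

Lemma Ec_diff_gpr b f : Ec_diff (Ec_gpr b f) = Ec_gpr (~~ b) (Ec_diff f).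
Proof. by apply: Ec_val_inj; apply: endo_diff_gpr; exact: Ec_ml. Qed.

Lemma Ec_diff_diff f : Ec_diff (Ec_diff f) = 0.
Proof. by apply: Ec_val_inj; apply: endo_diff_diff; exact: Ec_ml. Qed.

Definition Ec_dg : dgStructure (Ec form n) :=
  @DgStructure k (Ec form n) Ec_gpr Ec_diff Ec_gpr_gpr Ec_gpr_sum Ec_diff_gpr Ec_diff_diff.

End Grading.

Definition EcMod n : dgModType k := DgModType (Ec_dg n).

Lemma Ec_homog n b (f : EcMod n) : homog b f <-> hdeg b (Ec_val f).
Proof. by split=> [/(congr1 (@Ec_val _ _ _ _))|E]; last exact: Ec_val_inj. Qed.

Lemma Ec_perm_exists n (s : 'S_n.+1) (f : Ec form n) :
  exists h : Ec form n, perm_act s (alpha f) = alpha h.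
Proof.
have [hf Hf] := Ec_in f; have [h hh E] := Hf s.
by exists (mkEc (in_Ec_perm (Ec_in f) hh E)).
Qed.

(** The choice is harmless, since alpha is injective. *)
Definition Ec_cyc n (s : 'S_n.+1) (f : EcMod n) : EcMod n := projT1 (cid (Ec_perm_exists s f)).

Lemma alpha_cyc n (s : 'S_n.+1) (f : EcMod n) :
  alpha (Ec_cyc s f : Ec form n) = perm_act s (alpha (f : Ec form n)).
Proof. by rewrite /Ec_cyc; case: cid. Qed.

(** Defining the action of S_n by restriction makes its axioms instances of those
    of S_(n+1); [Ec_val_act] shows that it is the usual one. *)
Definition Ec_act n (s : 'S_n) (f : EcMod n) : EcMod n :=
  Ec_cyc (lift_perm ord_max ord_max s) f.

Lemma Ec_val_act n (s : 'S_n) (f : EcMod n) : Ec_val (Ec_act s f) = perm_act s (Ec_val f).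
Proof.
apply: (alpha_inj nondeg); rewrite alpha_cyc alpha_perm_lift //.
exact: Ec_ml.
Qed.

Lemma Ec_cyc_linear n (s : 'S_n.+1) : linear (Ec_cyc s).
Proof.
move=> c f g; apply: Ec_alpha_inj.
by rewrite [LHS]alpha_cyc [RHS]alphaP -!alpha_cyc alpha_cyc alphaP perm_actP !alpha_cyc.
Qed.

Lemma Ec_cyc_gpr n (s : 'S_n.+1) b (f : EcMod n) :
  Ec_cyc s (gpr (EcMod n) b f) = gpr (EcMod n) b (Ec_cyc s f).
Proof.
apply: Ec_alpha_inj; rewrite [LHS]alpha_cyc.
apply: alpha_gpr_perm; [exact: Ec_ml|exact: Ec_ml|by rewrite alpha_cyc].
Qed.

Lemma Ec_cyc_diff n (s : 'S_n.+1) (f : EcMod n) :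
  Ec_cyc s (diff (EcMod n) f) = diff (EcMod n) (Ec_cyc s f).
Proof.
have cycD := linD (@Ec_cyc_linear n s).
rewrite -(gpr_sum f) (linearD (diff (EcMod n))) !cycD (linearD (diff (EcMod n))).
suff H b : Ec_cyc s (diff (EcMod n) (gpr (EcMod n) b f)) =
    diff (EcMod n) (Ec_cyc s (gpr (EcMod n) b f)) by rewrite !H.
set fb := gpr _ _ _; have hb : homog b fb by exact: homog_gpr.
have hb' : homog b (Ec_cyc s fb) by rewrite /homog -Ec_cyc_gpr hb.
apply: Ec_alpha_inj; rewrite [LHS]alpha_cyc.
move/Ec_homog: hb; move/Ec_homog: hb' => hb' hb.
by apply: alpha_diff_perm hb hb' _; [exact: Ec_ml|exact: Ec_ml|rewrite alpha_cyc].
Qed.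

Lemma Ec_cyc1 n (f : EcMod n) : Ec_cyc (1%g : 'S_n.+1) f = f.
Proof.
by apply: Ec_alpha_inj; rewrite alpha_cyc perm_act1 //; apply: ml_alpha; exact: Ec_ml.
Qed.

Lemma Ec_cycM n (s t : 'S_n.+1) (f : EcMod n) : Ec_cyc (s * t)%g f = Ec_cyc t (Ec_cyc s f).
Proof.
apply: Ec_alpha_inj; rewrite !alpha_cyc perm_actM //.
by apply: ml_alpha; exact: Ec_ml.
Qed.

Definition Ec_id : EcMod 1 := mkEc (in_Ec_id form).

Definition Ec_comp m n p (E : (m + n = p.+1)%N) (i : 'I_m) (f : EcMod m) (g : EcMod n) : EcMod p :=
  mkEc (in_Ec_comp nondeg E i (Ec_in f) (Ec_in g)).

Definition Ec_operad : dgOperad EcMod.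
Proof.
apply: (@DgOperad k EcMod Ec_id Ec_act Ec_comp).
- by move=> n s; exact: Ec_cyc_linear.
- by move=> n s b f; exact: Ec_cyc_gpr.
- by move=> n s f; exact: Ec_cyc_diff.
- by move=> n f; rewrite /Ec_act lift_perm1 Ec_cyc1.
- by move=> n s t f; rewrite /Ec_act -(lift_permM _ ord_max) Ec_cycM.
- by move=> m n p e i g c f f'; apply: Ec_val_inj; apply: endo_compPl.
- by move=> m n p e i f c g g'; apply: Ec_val_inj; apply: endo_compPr; exact: Ec_ml.
- move=> m n p e i a b f g /Ec_homog ha /Ec_homog hb; apply/Ec_homog.
  by apply: hdeg_endo_comp => //; exact: Ec_ml.
- move=> m n p e i a f g /Ec_homog ha; apply: Ec_val_inj.
  by apply: endo_comp_diff => //; exact: Ec_ml.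
- by apply/Ec_homog; exact: hdeg_endo_id.
- apply: Ec_val_inj; apply: ev_ext => [||e u hu].
  + exact: Ec_ml.
  + exact: multilinear0.
  + rewrite (ev_endo_diff (@ml_endo_id k V) (@hdeg_endo_id k V) hu).
    by rewrite big_nat1 psum0 scale1r /ev /endo_id /dupdate /update eqxx subrr.
- by move=> m e i f; apply: Ec_val_inj; apply: endo_compf1 => //; exact: Ec_ml.
- by move=> m e i f; apply: Ec_val_inj; apply: endo_comp1f => //; exact: Ec_ml.
- move=> m n l p q r e1 e2 e3 e4 i j x f g h E; apply: Ec_val_inj.
  by apply: endo_comp_seq => //; exact: Ec_ml.
- move=> m n l p q r e1 e2 e3 e4 i j x y b c f g h ij Ex Ey /Ec_homog hb /Ec_homog hc.
  by apply: Ec_val_inj; apply: endo_comp_par => //; exact: Ec_ml.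
- move=> m n p e i s t r f g H1 H2; apply: Ec_val_inj.
  rewrite Ec_val_act /= !Ec_val_act.
  by apply: endo_comp_act => //; exact: Ec_ml.
Defined.

Definition Ec_cyclic : cyclicOperad EcMod.
Proof.
apply: (@CyclicOperad k EcMod Ec_operad Ec_cyc).
- by move=> n s; exact: Ec_cyc_linear.
- by move=> n s b f; exact: Ec_cyc_gpr.
- by move=> n s f; exact: Ec_cyc_diff.
- by move=> n f; exact: Ec_cyc1.
- by move=> n s t f; exact: Ec_cycM.
- by [].
- apply: Ec_alpha_inj; rewrite alpha_cyc; exact: rotate_id.
- move=> m n p e e' i j a b f g im j0 /Ec_homog ha /Ec_homog hb.
  have hf' : hdeg a (Ec_val (Ec_cyc (cycle_perm m) f)).
    apply: (hdeg_perm nondeg (s := cycle_perm m)) ha; try exact: Ec_ml.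
    by rewrite alpha_cyc.
  apply: Ec_alpha_inj; rewrite alpha_cyc.
  by apply: (endo_comp_rotate_last e (f' := Ec_val (Ec_cyc (cycle_perm m) f))) => //;
    try exact: Ec_ml; rewrite alpha_cyc.
- move=> m n p e i i' f g E; apply: Ec_alpha_inj; rewrite alpha_cyc.
  by apply: endo_comp_rotate => //; try exact: Ec_ml; rewrite alpha_cyc.
Defined.

End CyclicOperadStructure.

Theorem propositionB2 (k : fieldType) (k_char0 : [pchar k] =i pred0)
    (V : dgModType k) (form : innerProduct V) (nondeg : weakly_nondegenerate form) :
  exists (D : forall n : nat, dgStructure (Ec form n))
         (C : cyclicOperad (fun n : nat => DgModType (D n))),
    is_suboperad C /\
    forall (n : nat) (s : 'S_n.+1) (f : Ec form n),
      alpha form (Ec_val (cyc_act C s f)) = perm_act s (alpha form (Ec_val f)).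
Proof.
exists (Ec_dg nondeg), (Ec_cyclic nondeg); split; last exact: alpha_cyc.
split=> //; exact: Ec_val_act.
Qed.
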